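(* Let $d,n,p$ be integers with $d\ge 1$, $d\le n\le 2d+1$ and $0\le p\le[\frac d2]$. Then $$\mathbf{H}_{d,n,p}/O(n+1;\mathbb{R})\;\cong\;\mathbf{S}_{d,n,p}/U(1)\times SU(2),$$ that is, the assignment $[EZ_{d,p}]\mapsto[{}^tEE]$ is a well-defined bijection between these two sets.
   Context: $\mathcal{Q}_{n-1}=\{z_0^2+\cdots+z_n^2=0\}\subset\mathbb{C}P^n$. The Veronese maps $Z_{d,p}:\mathbb{C}P^1\to\mathbb{C}P^d$, $0\le p\le d$, are given in the affine coordinate $z=v/u$ by the column vectors $Z_{d,p}={}^t(g_{p,0}(z),\ldots,g_{p,d}(z))$ with $$g_{p,l}(z)=\frac{p!}{(1+|z|^2)^p}\sqrt{\tbinom dl}\,z^{l-p}\sum_k(-1)^k\tbinom{l}{p-k}\tbinom{d-l}{k}|z|^{2k}.$$ $\mathbf{H}_{d,n,p}$ is the set of $2$-spheres $EZ_{d,p}$ with $E$ a complex $(n+1)\times(d+1)$ matrix, $E^*E=Id_{d+1}$, and $EZ_{d,p}$ lying in $\mathcal{Q}_{n-1}$ (these are constantly curved $2$-spheres minimal in both $\mathcal{Q}_{n-1}$ and $\mathbb{C}P^n$). Two elements of $\mathbf{H}_{d,n,p}$ are equivalent if one is carried to the other by some $A\in O(n+1;\mathbb{R})$ together with some $SU(2)$-reparametrization of $\mathbb{C}P^1$; $\mathbf{H}_{d,n,p}/O(n+1;\mathbb{R})$ denotes the set of equivalence classes. $\mathscr{S}_{d,p}=\{S\in Sym_{d+1}(\mathbb{C})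 : {}^tZ_{d,p}\,S\,Z_{d,p}=0\}$, where $Sym_{d+1}(\mathbb{C})$ is the space of complex symmetric $(d+1)\times(d+1)$ matrices. $\mathbf{S}_{d,n,p}$ is the set of $S\in\mathscr{S}_{d,p}$ all of whose singular values are $\le 1$ and for which $1$ is a singular value with multiplicity at least $2d+1-n$ (no multiplicity condition if $n=2d+1$). The group $U(1)\times SU(2)$ acts on $\mathbf{S}_{d,n,p}$ by $(\lambda,g,S)\mapsto\lambda\,{}^t\rho^{\frac d2}(g)\,S\,\rho^{\frac d2}(g)$, where $\rho^{\frac d2}(g)\in U(d+1)$ is the matrix of the irreducible representation of $SU(2)$ on homogeneous polynomials of degree $d$ in $(u,v)$, $f\mapsto f\circ g^*$ (for $g=\begin{pmatrix}a&b\\-\bar b&\bar a\end{pmatrix}$, $(f\circ g^* )(u,v)=f(\bar au-bv,\bar bu+av)$), in the orthonormal basis $e_l=\binom dl^{1/2}u^{d-l}v^l$: $(e_0,\ldots,e_d)\cdot\rho^{\frac d2}(g)=(e_0\circ g^*,\ldots,e_d\circ g^* )$. The quotient is the set of orbits. *)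

(* Defs.v *)
From HB Require Import structures.
From mathcomp Require Import all_boot all_order all_algebra.
From mathcomp Require Import spectral complex zify ring.
From mathcomp Require Import classical_sets functions reals.

Set Implicit Arguments.
Unset Strict Implicit.
Unset Printing Implicit Defensive.

Import Order.TTheory GRing.Theory Num.Theory.

Local Open Scope ring_scope.
Local Open Scope sesquilinear_scope.
Local Open Scope classical_set_scope.

(* The development is over a numClosedFieldType C up to the section           *)
(* MinimalSpheres, where C := R[i] for R : realType.                          *)

Section ProjectiveSpace.
Variable C : numClosedFieldType.

Definition CP (n : nat) := {L : {vspace 'cV[C]_n.+1} | \dim L == 1%N}.

Lemma dim_vline_neq0 n (v : 'cV[C]_n.+1) : v != 0 -> \dim <[v]>%VS == 1%N.
Proof. by rewrite dim_vline => ->. Qed.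

Definition point n (v : 'cV[C]_n.+1) (hv : v != 0) : CP n :=
  exist _ <[v]>%VS (dim_vline_neq0 hv).

Definition quadric n : set (CP n) :=
  [set x : CP n | forall w : 'cV[C]_n.+1, w \in sval x ->
    \sum_(i < n.+1) w i 0 ^+ 2 = 0].

Definition isom_mx m n := {E : 'M[C]_(m.+1, n.+1) | E^t* *m E == 1%:M}.

Lemma isom_mx_dim m n (E : isom_mx m n) (x : CP n) :
  \dim (linfun (mulmx (sval E)) @: sval x)%VS == 1%N.
Proof.
case: E x => E hE [L hL] /=; rewrite limg_dim_eq //.
rewrite [lker _](_ : _ = 0%VS) ?capv0 //.
apply/eqP; rewrite -subv0; apply/subvP => v.
rewrite memv_ker lfunE /= memv0 => /eqP Ev0.
by rewrite -[v]mul1mx -(eqP hE) -mulmxA Ev0 mulmx0.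
Qed.

Definition CPmap m n (E : isom_mx m n) (x : CP n) : CP m :=
  exist _ (linfun (mulmx (sval E)) @: sval x)%VS (isom_mx_dim E x).

Definition SU2 := {g : isom_mx 1 1 | \det (sval g) == 1}.

End ProjectiveSpace.

Section Veronese.
Variable C : numClosedFieldType.

(* The power of z is an integer power. If l < p it is a negative one, and at  *)
(* z = 0 the convention 0^-1 = 0 makes the entry 0, which is its limit, since *)
(* each nonzero term of the sum then has k >= p - l.                          *)
Definition veronese_coord (d p l : nat) (z : C) : C :=
  p`!%:R / (1 + `|z| ^+ 2) ^+ p * sqrtC 'C(d, l)%:R * z ^ (l%:Z - p%:Z) *
  \sum_(k < p.+1)
     (-1) ^+ k * ('C(l, p - k) * 'C(d - l, k))%:R * `|z| ^+ (2 * k).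

Definition veronese (d p : nat) (z : C) : 'cV[C]_d.+1 :=
  \col_(l < d.+1) veronese_coord d p l z.

(* Lift of the extension of the Veronese map to CP^1: z = v / u where u <> 0, *)
(* and the limit point as z tends to infinity, spanned by the basis vector of *)
(* index d - p, where u = 0. That this is the right extension is veroneseLE:  *)
(* the same line is spanned by a vector depending continuously on (u, v).     *)
Definition veroneseL (d : nat) (p : 'I_d.+1) (w : 'cV[C]_2) : 'cV[C]_d.+1 :=
  if w 0 0 == 0 then delta_mx (rev_ord p) 0 else veronese d p (w 1 0 / w 0 0).

Lemma veroneseLZ d (p : 'I_d.+1) (c : C) (w : 'cV[C]_2) :
  c != 0 -> veroneseL p (c *: w) = veroneseL p w.
Proof.
move=> c0; rewrite /veroneseL !mxE mulf_eq0 (negPf c0) /=.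
by case: ifP => // _; rewrite -mulf_div divff // mul1r.
Qed.

Lemma veronese_factor_neq0 p (z : C) : p`!%:R / (1 + `|z| ^+ 2) ^+ p != 0.
Proof.
rewrite mulf_neq0 ?invr_eq0 ?pnatr_eq0 -?lt0n ?fact_gt0 //.
by rewrite expf_neq0 // gt_eqF // ltr_pwDl // exprn_ge0.
Qed.

Lemma veronese_neq0 d p (z : C) : (p <= d)%N -> veronese d p z != 0.
Proof.
move=> lepd.
have sq0 l : (l <= d)%N -> sqrtC 'C(d, l)%:R != 0 :> C.
  by move=> led; rewrite sqrtC_eq0 pnatr_eq0 -lt0n bin_gt0.
have := veronese_factor_neq0 p z.
case: (eqVneq z 0) => [->|z0] f0; apply/eqP => /matrixP.
- move=> /(_ (Ordinal (lepd : p < d.+1)%N) 0); rewrite !mxE /=.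
  apply/eqP; rewrite /veronese_coord subrr expr0z mulr1 big_ord_recl /= subn0.
  rewrite binn bin0 muln1 !expr0 !mulr1 big1 ?addr0.
    by rewrite mulr1 mulf_neq0 ?sq0.
  by move=> i _; rewrite normr0 expr0n mulr0.
- move=> /(_ ord_max 0); rewrite !mxE /=; apply/eqP.
  rewrite /veronese_coord big_ord_recl /= subn0 bin0 muln1 !expr0 mulr1 mul1r.
  rewrite big1 ?addr0; last first.
    by move=> i _; rewrite subnn bin0n muln0 mulr0 mul0r.
  rewrite mulf_neq0 // ?pnatr_eq0 -?lt0n ?bin_gt0 //.
  by rewrite mulf_neq0 ?expfz_neq0 // mulf_neq0 ?sq0.
Qed.

Lemma veroneseL_neq0 d (p : 'I_d.+1) (w : 'cV[C]_2) : veroneseL p w != 0.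
Proof.
rewrite /veroneseL; case: ifP => _; last by rewrite veronese_neq0 // -ltnS.
apply/eqP => /matrixP/(_ (rev_ord p) 0); rewrite !mxE !eqxx /=.
by apply/eqP; rewrite oner_eq0.
Qed.

Definition veronese_hom (d p : nat) (w : 'cV[C]_2) : 'cV[C]_d.+1 :=
  \col_(l < d.+1) (sqrtC 'C(d, l)%:R *
    \sum_(k < p.+1) (-1) ^+ k * ('C(l, p - k) * 'C(d - l, k))%:R *
      (w 0 0 ^+ (d - l - k) * w 1 0 ^+ (l - (p - k)) *
       (w 0 0)^* ^+ (p - k) * (w 1 0)^* ^+ k)).

Lemma veronese_homE d p (w : 'cV[C]_2) : (p <= d)%N -> w 0 0 != 0 ->
  veronese d p (w 1 0 / w 0 0) =
    (p`!%:R / (1 + `|w 1 0 / w 0 0| ^+ 2) ^+ p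
       / (w 0 0 ^+ (d - p) * (w 0 0)^* ^+ p)) *: veronese_hom d p w.
Proof.
move=> lepd; set u := w 0 0 => u0; set z := w 1 0 / u.
have ev : w 1 0 = z * u by rewrite divfK.
have cu0 : u^* != 0 by rewrite conjC_eq0.
clearbody z; apply/matrixP => l j; rewrite !mxE /veronese_coord -/u.
clearbody u.
rewrite -!mulrA.
congr (_ * (_ * _)); rewrite [RHS]mulrCA; congr (_ * _).
rewrite !mulr_sumr; apply: eq_bigr => k _.
rewrite ev; clear ev.
rewrite -!mulrA mulrCA [RHS]mulrCA; congr (_ * _).
have [lt|le] := ltnP l (p - k).
  by rewrite bin_small // !mul0r !mulr0.
have [lt|le2] := ltnP (d - l) k.
  by rewrite [X in (_ * X)%N]bin_small // muln0 !mul0r !mulr0.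
rewrite mulrCA [RHS]mulrCA; congr (_ * _).
have lekp : (k <= p)%N by rewrite -ltnS.
rewrite rmorphM !exprMn exprM normCK exprMn.
have -> : z ^ (l%:Z - p%:Z) * (z ^+ k * z^* ^+ k) =
          z ^+ (l - (p - k)) * z^* ^+ k.
  case: (eqVneq z 0) => [->|z0].
    rewrite rmorph0; case: (posnP k) => [k0|k0]; last first.
      by rewrite !expr0n !(gtn_eqF k0) !mulr0.
    rewrite k0 subn0 !expr0 !mulr1.
    by rewrite subzn //; move: le; rewrite k0 subn0.
  rewrite mulrA; congr (_ * _).
  rewrite !exprnP -expfzDr //; congr (exprz z _).
  by rewrite -(subzn le) -(subzn lekp) opprB addrA addrAC.
set a := z ^+ _; set b := z^* ^+ _.
have eu : u ^+ (d - p) = u ^+ (d - l - k) * u ^+ (l - (p - k)).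
  rewrite -exprD; congr (_ ^+ _).
  have led : (l <= d)%N by rewrite -ltnS.
  by apply/eqP; rewrite -(eqn_add2r p); apply/eqP; lia.
have ecu : u^* ^+ p = u^* ^+ (p - k) * u^* ^+ k by rewrite -exprD subnK.
rewrite eu ecu.
move: (expf_neq0 (d - l - k) u0) (expf_neq0 (l - (p - k)) u0).
move: (expf_neq0 (p - k) cu0) (expf_neq0 k cu0).
move: (u ^+ _) (u ^+ _) (u^* ^+ _) (u^* ^+ _) => x1 x2 x3 x4 h3 h4 h1 h2.

have -> : x2 * (a * x1 * (x4 * (b * x3))) = x2 * x1 * (x4 * x3) * (a * b).
  by ring.
by rewrite mulKf // !mulf_neq0.
Qed.

Lemma veroneseLE d (p : 'I_d.+1) (w : 'cV[C]_2) : w != 0 ->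
  <[veroneseL p w]>%VS = <[veronese_hom d p w]>%VS.
Proof.
have lepd : (p <= d)%N by rewrite -ltnS.
have vlineZ (c : C) (x : 'cV[C]_d.+1) : c != 0 -> <[c *: x]>%VS = <[x]>%VS.
  move=> c0; apply/eqP; rewrite eqEsubv -!memvE memvZ ?memv_line //=.
  by rewrite -[X in X \in _](scalerK c0) memvZ ?memv_line.
move=> w0; rewrite /veroneseL; case: ifPn => [u0|u0]; last first.
  rewrite veronese_homE // vlineZ // mulf_neq0 ?veronese_factor_neq0 //.
  by rewrite invr_neq0 // mulf_neq0 ?expf_neq0 // conjC_eq0.
have v0 : w 1 0 != 0.
  apply: contraNneq w0 => v0; apply/eqP/matrixP => i j; rewrite mxE ord1.
  case: i => [[|[|//]] hi].
    by rewrite -(eqP u0); congr (w _ _); apply/val_inj.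
  by rewrite -v0; congr (w _ _); apply/val_inj.
have cv0 : (w 1 0)^* != 0 by rewrite conjC_eq0.
suff -> : veronese_hom d p w = (sqrtC 'C(d, d - p)%:R * ((-1) ^+ p *
    (w 1 0 ^+ (d - p) * (w 1 0)^* ^+ p))) *: delta_mx (rev_ord p) 0.
  rewrite vlineZ // !mulf_neq0 ?expf_neq0 ?oppr_eq0 ?oner_eq0 //.
  by rewrite sqrtC_eq0 pnatr_eq0 -lt0n bin_gt0 leq_subr.
apply/matrixP => l j; rewrite !mxE ord1 eqxx andbT (eqP u0) rmorph0.
rewrite big_ord_recr /= big1 ?add0r; last first.
  move=> k _; rewrite [X in _ * X](_ : _ = 0) ?mulr0 //.
  have -> : 0 ^+ (p - k) = 0 :> C by rewrite expr0n subn_eq0 leqNgt ltn_ord.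
  by rewrite mulr0 mul0r.
rewrite subnn subn0 bin0 mul1n expr0 mulr1.
have [->|nl] := eqVneq l (rev_ord p).
  rewrite /= subSS subKn // binn subnn expr0 mul1r mulr1.
  by rewrite !mulr1.
rewrite mulr0; have [lt|le] := ltnP (d - l) p.
  by rewrite (bin_small lt) mulr0 mul0r mulr0.
rewrite (_ : 0 ^+ (d - l - p) = 0) ?mul0r ?mulr0 //.
rewrite expr0n; case: eqP => // h; case/eqP: nl; apply/val_inj => /=.
have led : (l <= d)%N by rewrite -ltnS.
by rewrite subSS; lia.
Qed.

(* veroneseL p w depends only on the line spanned by w (veroneseLZ), so the   *)
(* choice made by vpick is immaterial.                                        *)
Definition veronese_map (d : nat) (p : 'I_d.+1) (x : CP C 1) : CP C d :=
  point (veroneseL_neq0 p (vpick (sval x))).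

End Veronese.

Section Representation.
Variable C : numClosedFieldType.

Definition hom_basis (d l : nat) (w : 'cV[C]_2) : C :=
  sqrtC 'C(d, l)%:R * w 0 0 ^+ (d - l) * w 1 0 ^+ l.

(* A homogeneous polynomial of degree d in (u, v) is encoded by its value at  *)
(* (1, 'X). By rho_irrE, rho_irr d g is the matrix of f |-> f \o g^t* in the  *)
(* basis hom_basis d 0, ..., hom_basis d d.                                   *)
Definition rho_irr (d : nat) (g : 'M[C]_2) : 'M[C]_d.+1 :=
  \matrix_(k < d.+1, l < d.+1)
    (sqrtC 'C(d, l)%:R / sqrtC 'C(d, k)%:R *
     ((((g^t* ) 0 0)%:P + (g^t* ) 0 1 *: 'X) ^+ (d - l) *
      (((g^t* ) 1 0)%:P + (g^t* ) 1 1 *: 'X) ^+ l)`_k).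

Lemma homogenize_mul m (P : {poly C}) (a b u v x : C) :
    (size P <= m.+1)%N /\ \sum_(k < m.+1) P`_k * (u ^+ (m - k) * v ^+ k) = x ->
  (size ((a%:P + b *: 'X) * P)%R <= m.+2)%N /\
  \sum_(k < m.+2) ((a%:P + b *: 'X) * P)`_k * (u ^+ (m.+1 - k) * v ^+ k) =
    (a * u + b * v) * x.
Proof.
case=> sP <-; split.
  apply: (leq_trans (size_polyMleq _ _)).
  have : (size (a%:P + b *: 'X)%R <= 2)%N.
    apply: (leq_trans (size_polyD _ _)); rewrite geq_max.
    rewrite (leq_trans (size_polyC_leq1 _)) //=.
    by rewrite (leq_trans (size_scale_leq _ _)) // size_polyX.
  by move=> s2; move: (leq_add s2 sP); case: (_ + _)%N.
rewrite !mulrDl !mulr_sumr.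
under eq_bigr => k _ do
  rewrite coefD mul_polyC coefZ -scalerAl coefZ coefXM mulrDl.
rewrite big_split /=; congr (_ + _).
  rewrite big_ord_recr /= nth_default ?mulr0 ?mul0r ?addr0 //.
  apply: eq_bigr => k _; have lekm : (k <= m)%N by rewrite -ltnS.
  by rewrite subSn // exprS -!mulrA; congr (_ * _); rewrite mulrCA.
rewrite big_ord_recl /= mulr0 mul0r add0r; apply: eq_bigr => k _.
rewrite /bump /= add1n subSS exprS -!mulrA; congr (_ * _).
by rewrite [RHS]mulrCA; congr (_ * _); rewrite mulrCA.
Qed.

Lemma rho_irrE (d : nat) (g : 'M[C]_2) (l : 'I_d.+1) (w : 'cV[C]_2) :
  hom_basis d l (g^t* *m w) = \sum_(k < d.+1) hom_basis d k w * rho_irr d g k l.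
Proof.
set h := g^t*.
have led : (l <= d)%N by rewrite -ltnS.
have E (i j : nat) : let P := ((h 0 0)%:P + h 0 1 *: 'X) ^+ i *
      ((h 1 0)%:P + h 1 1 *: 'X) ^+ j in
    (size P <= (i + j).+1)%N /\
    \sum_(k < (i + j).+1) P`_k * (w 0 0 ^+ (i + j - k) * w 1 0 ^+ k) =
      (h *m w) 0 0 ^+ i * (h *m w) 1 0 ^+ j.
  have row2 a : (h *m w) a 0 = h a 0 * w 0 0 + h a 1 * w 1 0.
    by rewrite mxE big_ord_recl big_ord1; congr (_ + _ * _); congr (_ _ _);
      apply/val_inj.
  rewrite /= !row2; elim: i => [|i IH]; last first.
    by rewrite !exprS -!mulrA addSn; apply: homogenize_mul.
  rewrite !expr0 !mul1r add0n; elim: j => [|j IH].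
    by split; rewrite expr0 ?size_poly1 // big_ord1 coef1 /= !mulr1.
  by rewrite !exprS; apply: homogenize_mul.
have [_] := E (d - l)%N l; rewrite subnK // => E1.
rewrite /hom_basis -mulrA -E1 mulr_sumr; apply: eq_bigr => k _.
rewrite [rho_irr _ _ _ _]mxE -/h -!mulrA.
have s0 : sqrtC 'C(d, k)%:R != 0 :> C.
  by rewrite sqrtC_eq0 pnatr_eq0 -lt0n bin_gt0 -ltnS.
move: (sqrtC _) s0 => s s0; move: (sqrtC _) => t.
move: (nth 0 _ _) (w 0 0 ^+ _) (w 1 0 ^+ _) => P x y /=.
have e : s * (x * (y * (t * (s^-1 * P)))) = (s / s) * (t * (P * (x * y))).
  by ring.
by rewrite e divff // mul1r.
Qed.

End Representation.

Section MinimalSpheres.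
Variable R : realType.
Local Notation C := R[i].

Definition real_orthogonal n := {A : 'M[R]_n.+1 | A^T *m A == 1%:M}.

Lemma real_orthogonal_isom n (A : real_orthogonal n) :
  (map_mx (real_complex R) (sval A))^t* *m map_mx (real_complex R) (sval A)
    == 1%:M.
Proof.
case: A => A hA /=.
have -> : (map_mx (real_complex R) A)^t* = map_mx (real_complex R) A^T.
  by apply/matrixP => i j; rewrite !mxE; exact: conjc_real.
by rewrite -map_mxM (eqP hA) map_mx1.
Qed.

Definition complexify n (A : real_orthogonal n) : isom_mx C n n :=
  exist _ (map_mx (real_complex R) (sval A)) (real_orthogonal_isom A).

Section SphereClasses.
Variables (d n : nat) (p : 'I_d.+1).

Definition sphere (E : isom_mx C n d) : CP C 1 -> CP C n :=
  fun x => CPmap E (veronese_map p x).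

Definition HH : set (CP C 1 -> CP C n) :=
  [set f | exists2 E, f = sphere E & forall x, quadric (f x)].

Definition sphere_equiv (f f' : CP C 1 -> CP C n) : Prop :=
  exists (A : real_orthogonal n) (g : SU2 C),
    forall x, f' x = CPmap (complexify A) (f (CPmap (sval g) x)).

Definition HH_class (f : CP C 1 -> CP C n) : set (CP C 1 -> CP C n) :=
  [set f' | HH f' /\ sphere_equiv f f'].

Definition HH_quot : set (set (CP C 1 -> CP C n)) := [set HH_class f | f in HH].

End SphereClasses.

(* The singular values of S are the s >= 0 such that s^2 is an eigenvalue of  *)
(* S^* S, which is diagonalizable, so that multiplicities are dimensions of   *)
(* eigenspaces.                                                               *)
Definition singular_value m (S : 'M[C]_m) (s : R) : bool :=
  (0 <= s) && eigenvalue (S^t* *m S) (real_complex R s ^+ 2).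

Definition singular_mult m (S : 'M[C]_m) (s : R) : nat :=
  \rank (eigenspace (S^t* *m S) (real_complex R s ^+ 2)).

Definition scrS (d p : nat) : set 'M[C]_d.+1 :=
  [set S | S^T = S /\
    forall z : C, (veronese d p z)^T *m S *m veronese d p z = 0].

(* The subtraction is truncated: there is no condition if n = 2 * d + 1.      *)
Definition SS (d n p : nat) : set 'M[C]_d.+1 :=
  [set S | [/\ scrS p S, forall s, singular_value S s -> s <= 1
             & (2 * d + 1 - n <= singular_mult S 1)%N]].

Definition SS_orbit (d : nat) (S : 'M[C]_d.+1) : set 'M[C]_d.+1 :=
  [set S' | exists (lambda : C) (g : SU2 C), `|lambda| = 1 /\
    S' = lambda *: ((rho_irr d (sval (sval g)))^T *m S
                      *m rho_irr d (sval (sval g)))].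

Definition SS_quot (d n p : nat) : set (set 'M[C]_d.+1) :=
  [set @SS_orbit d S | S in SS n p].

End MinimalSpheres.

Arguments HH {R d} n p.
Arguments HH_quot R {d} n p.
Arguments SS_quot R d n p : clear implicits.

(* Main.v *)
Require Import Defs.
From mathcomp Require Import all_boot all_order all_algebra.
From mathcomp Require Import spectral complex ring zify.
From mathcomp Require Import classical_sets functions reals.

Set Implicit Arguments.
Unset Strict Implicit.
Unset Printing Implicit Defensive.

Import Order.TTheory GRing.Theory Num.Theory.
Local Open Scope ring_scope.
Local Open Scope sesquilinear_scope.

(** Write [S = E^T E] for an isometry [E]. The theorem says that the sphere
    [E Z], up to real orthogonal congruence and reparametrization, is the same
    thing as the symmetric matrix [S] up to the action of U(1) x SU(2).

    The bridge between [E] and [S] is a real Gram matrix. The left action of the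
    real orthogonal group on [E] is its action on the real and imaginary parts of
    the columns of [E], and the Gram matrix of these real vectors is determined
    by [E^* E = 1] and [E^T E = S]. Frames with equal Gram matrices differ by an
    orthogonal matrix ([gram_orthogonal]), so [S] determines [E] up to
    O(n+1) ([gram_unique]). Conversely a positive real symmetric matrix of rank
    at most [n + 1] is the Gram matrix of vectors in dimension [n + 1]
    ([psd_factor]). For the matrix built from [S] positivity means that the
    singular values of [S] are at most 1, and the rank bound is the condition on
    the multiplicity of the singular value 1; so every [S] in the target set
    arises ([gram_exists]), and only those do ([isometry_defect]). That the
    sphere lies in the quadric is the equation defining [scrS] ([HH_sphere]),
    the point at infinity being reached by a polynomial argument
    ([veronese_hom_null]).

    The Veronese maps of all orders are the Taylor coefficients of the one of
    order 0 in the direction of the quaternionic conjugate of [w]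
    ([hom_vec_perp]), so they inherit its SU(2)-equivariance
    ([veronese_hom_SU2]). Hence a reparametrization of the sphere replaces [E] by
    [E rho(g)] and [S] by [rho(g)^T S rho(g)].

    There remains the phase in U(1). A map into projective space only sees the
    line of [E Z], so equal spheres give [E' Z = c(z) E Z] with a factor that
    could depend on the point. Restricted to a circle of generic radius the
    Veronese curve is a monomial curve with all coefficients nonzero, and a
    matrix that preserves every line of such a curve is a scalar
    ([veronese_rigid]). So [c] is constant, of modulus 1, and [S] changes by
    [c^2]; conversely every phase is such a square. *)

(** * Real Gram matrices *)
Section RealGram.

Lemma mulmx_sq_eq0 (R : realDomainType) m (w : 'cV[R]_m) :
  (w^T *m w) 0 0 = 0 -> w = 0.
Proof.
move=> /eqP; rewrite mxE psumr_eq0 => [/allP w0|i _]; last first.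
  by rewrite mxE -expr2 sqr_ge0.
apply/matrixP => i j; have := w0 i (mem_index_enum _).
by rewrite ord1 !mxE mulf_eq0 orbb => /eqP.
Qed.


(** The reflection in the hyperplane orthogonal to [u - v]: it exchanges [u]
    and [v] because they have the same length, and fixes every vector that has
    the same inner product with both. *)
Lemma reflection_swap (R : realFieldType) m (u v : 'cV[R]_m) :
    (u^T *m u) 0 0 = (v^T *m v) 0 0 ->
  exists2 A : 'M[R]_m, A^T *m A = 1%:M &
    A *m u = v /\
    forall x : 'cV[R]_m, (x^T *m u) 0 0 = (x^T *m v) 0 0 -> A *m x = x.
Proof.
move=> uv; have [->|nuv] := eqVneq u v.
  by exists 1%:M; rewrite ?trmx1 ?mulmx1 //; split=> [|x _]; rewrite mul1mx.
set w := u - v; set c := (w^T *m w) 0 0.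
have c0 : c != 0.
  by apply: contraNneq nuv => /mulmx_sq_eq0/eqP; rewrite subr_eq0.
have ww : w^T *m w = c%:M by rewrite [LHS]mx11_scalar.
pose A : 'M[R]_m := 1%:M - (2 / c) *: (w *m w^T).
have trA : A^T = A.
  by rewrite /A linearB /= trmx1 linearZ /= trmx_mul trmxK.
have AE (x : 'cV[R]_m) : A *m x = x - (2 / c * (w^T *m x) 0 0) *: w.
  rewrite mulmxBl mul1mx -scalemxAl -mulmxA [w^T *m x]mx11_scalar.
  rewrite mul_mx_scalar scalerA.
  by rewrite [_%:M 0 0]mxE eqxx mulr1n.
have dotC (x y : 'cV[R]_m) : (x^T *m y) 0 0 = (y^T *m x) 0 0.
  by rewrite -[x^T *m y]trmxK trmx_mul trmxK mxE.
have dotB (x y z : 'cV[R]_m) :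
    ((x - y)^T *m z) 0 0 = (x^T *m z) 0 0 - (y^T *m z) 0 0.
  by rewrite linearB mulmxBl !mxE.
exists A; [rewrite trA | split=> [|x xuv]].
- rewrite {2}/A mulmxBr mulmx1 -scalemxAr mulmxA AE ww mxE eqxx mulr1n.
  rewrite divfK // scaler_nat mulr2n opprD addrA subrr sub0r mulNmx.
  by rewrite scalerN opprK subrK.
- rewrite AE; have -> : 2 / c * (w^T *m u) 0 0 = 1.
    rewrite mulrAC; suff -> : 2 * (w^T *m u) 0 0 = c by rewrite divff.
    rewrite /c /w !dotB !(dotC _ (u - v)) !dotB (dotC v u) uv.
    by ring.
  by rewrite scale1r /w opprB addrC subrK.
- by rewrite AE dotB !(dotC _ x) xuv subrr mulr0 scale0r subr0.
Qed.

(** Equal Gram matrices mean congruent frames. The columns are matched one at a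
    time by reflections; the reflection that corrects column [k] fixes the
    columns already matched, since their inner products with the old and the
    new column [k] agree. No basis or dimension count is involved, so the frames
    may be degenerate. *)
Lemma gram_orthogonal (R : realFieldType) m N (F F' : 'M[R]_(m, N)) :
    F^T *m F = F'^T *m F' ->
  exists2 A : 'M[R]_m, A^T *m A = 1%:M & F' = A *m F.
Proof.
move=> gram.
have gramE i j :
    ((col i F)^T *m col j F) 0 0 = ((col i F')^T *m col j F') 0 0.
  have E (X : 'M[R]_(m, N)) : ((col i X)^T *m col j X) 0 0 = (X^T *m X) i j.
    by rewrite !mxE; apply: eq_bigr => k _; rewrite !mxE.
  by rewrite !E gram.
suff /(_ N)[A oA AF] k : exists2 A : 'M[R]_m, A^T *m A = 1%:M &
    forall j : 'I_N, (j < k)%N -> A *m col j F = col j F'.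
  exists A => //; apply/matrixP => i j.
  have /matrixP/(_ i 0) := AF j (ltn_ord j).
  by rewrite colE mulmxA -colE !mxE.
(* Induction on the number [k] of columns already matched. *)
elim: k => [|k [A oA AF]]; first by exists 1%:M; rewrite ?trmx1 ?mulmx1.
have [leNk|ltkN] := leqP N k.
  by exists A => // j _; apply: AF; apply: leq_trans leNk.
pose j0 := Ordinal ltkN.
have dotA (x y : 'cV[R]_m) : (A *m x)^T *m (A *m y) = x^T *m y.
  by rewrite trmx_mul -mulmxA (mulmxA A^T) oA mul1mx.
have [|B oB [Bj0 Bfix]] := @reflection_swap R m (A *m col j0 F) (col j0 F').
  by rewrite dotA gramE.
exists (B *m A) => [|j].
  by rewrite trmx_mul -mulmxA (mulmxA B^T) oB mul1mx.
rewrite ltnS leq_eqVlt -mulmxA => /orP[/eqP jk|jk].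
  by rewrite (_ : j = j0) //; apply: val_inj.
by rewrite AF // Bfix // -gramE -AF // dotA.
Qed.

(** Lagrange reduction: as long as [G] is not zero, some [x] satisfies
    [x G x^T = c > 0], and subtracting the rank one form [c^-1 (xG)^T (xG)] keeps
    [G] positive (the result is the restriction of [G] to the orthogonal of [x]
    for [G], extended by zero) and puts
    [x] in the kernel, so that the rank drops. The number of rows of [F] is thus
    bounded by the rank of [G]. *)
Lemma psd_factor (R : rcfType) N r (G : 'M[R]_N) :
    G^T = G -> (forall x : 'rV[R]_N, 0 <= (x *m G *m x^T) 0 0) ->
  (\rank G <= r)%N -> exists F : 'M[R]_(r, N), G = F^T *m F.
Proof.
elim: r G => [|r IH] G symG psdG rG.
  exists 0; rewrite mulmx0; apply/eqP.
  by rewrite -mxrank_eq0 -leqn0.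
have [->|G0] := eqVneq G 0; first by exists 0; rewrite mulmx0.
have bilC (x y : 'rV[R]_N) : (x *m G *m y^T) 0 0 = (y *m G *m x^T) 0 0.
  transitivity ((x *m G *m y^T)^T 0 0); first by rewrite [RHS]mxE.
  by rewrite !trmx_mul trmxK symG mulmxA.
(* If the quadratic form vanishes on the basis, polarization finds [x] among
   the sums of two basis vectors. *)
have [x qx] : exists x : 'rV[R]_N, (x *m G *m x^T) 0 0 != 0.
  have [/existsP[i nz]|] :=
      boolP [exists i : 'I_N,
               (delta_mx 0 i *m G *m (delta_mx 0 i)^T : 'M_1) 0 0 != 0].
    by exists (delta_mx 0 i).
  rewrite negb_exists => /forallP dg.
  have E i j : (delta_mx 0 i *m G *m (delta_mx 0 j)^T : 'M_1) 0 0 = G i j.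
    by rewrite trmx_delta -rowE -colE !mxE.
  have [i [j nz]] : exists i, exists j, G i j != 0.
    have [/existsP[i /existsP[j nz]]|] :=
        boolP [exists i, exists j, G i j != 0].
      by exists i, j.
    rewrite negb_exists => /forallP z; case/eqP: G0; apply/matrixP => i j.
    have := z i; rewrite negb_exists => /forallP/(_ j).
    by rewrite mxE negbK => /eqP.
  exists (delta_mx 0 i + delta_mx 0 j).
  rewrite mulmxDl linearD mulmxDr !mulmxDl ![(_ + _ : 'M_1) 0 0]mxE !E.
  have := dg i; have := dg j; rewrite !E !negbK => /eqP -> /eqP ->.
  by rewrite (_ : G j i = G i j) ?addr0 ?add0r -?mulr2n ?mulrn_eq0 // -E bilC E.
set c := (x *m G *m x^T) 0 0 in qx.
have c_gt0 : 0 < c by rewrite lt_def qx psdG.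
have xGx : x *m G *m x^T = c%:M by rewrite [LHS]mx11_scalar.
pose y := x *m G.
pose G' := G - c^-1 *: (y^T *m y).
have yT : y^T = G *m x^T by rewrite trmx_mul symG.
(* [P] is the projection along [x] onto its orthogonal for [G]. *)
pose P := 1%:M - c^-1 *: (G *m x^T *m x).
have G'E : G' = P *m G *m P^T.
  have PG : P *m G = G'.
    by rewrite mulmxBl mul1mx -scalemxAl /G' yT /y !mulmxA.
  have G'x : G' *m x^T = 0.
    rewrite mulmxBl -scalemxAl -mulmxA /y xGx mul_mx_scalar scalerA.
    by rewrite mulVf // scale1r yT subrr.
  rewrite PG /P linearB /= trmx1 linearZ /= trmx_mul mulmxBr mulmx1.
  by rewrite -scalemxAr mulmxA G'x mul0mx scaler0 subr0.
have [|z||F' F'E] := IH G'.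
- by rewrite /G' linearB /= linearZ /= trmx_mul trmxK symG.
- by rewrite G'E !mulmxA -(mulmxA (z *m P *m G)) -trmx_mul psdG.
- have xG' : x *m G' = 0.
    rewrite mulmxBr -scalemxAr yT !mulmxA xGx mul_scalar_mx -scalemxAl scalerA.
    by rewrite mulVf // scale1r subrr.
  have : (kermx G < kermx G')%MS.
    apply/andP; split.
      apply/sub_kermxP; rewrite mulmxBr mulmx_ker -scalemxAr yT !mulmxA.
      by rewrite mulmx_ker !mul0mx scaler0 subr0.
    apply/negP => kk.
    have /submx_trans/(_ kk)/sub_kermxP xG0 : (x <= kermx G')%MS.
      exact/sub_kermxP.
    by move: qx; rewrite /c xG0 mul0mx mxE eqxx.
  move/rank_ltmx; rewrite !mxrank_ker; have := rank_leq_row G'; lia.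
pose F : 'M[R]_(1 + r, N) := col_mx (Num.sqrt c^-1 *: y) F'.
suff GF : G = F^T *m F by exists F.
rewrite /F tr_col_mx mul_row_col -F'E -scalemxAr [_^T]linearZ /=.
rewrite -scalemxAl scalerA.
by rewrite -expr2 sqr_sqrtr ?invr_ge0 ?ltW // /G' addrC subrK.
Qed.

End RealGram.

(** * Polynomials with infinitely many zeros *)
Section Polynomials.
Variable F : idomainType.

Lemma exists_nonroot (a : nat -> F) (P : {poly F}) :
  injective a -> P != 0 -> exists m, P.[a m] != 0.
Proof.
move=> inja nzP.
pose s := [seq a m | m <- iota 0 (size P)].
have [/allPn[_ /mapP[m _ ->] Pm]|] := boolP (~~ all (root P) s).
  by exists m.
rewrite negbK => /(max_poly_roots nzP); rewrite size_map size_iota ltnn.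
by rewrite map_inj_uniq // iota_uniq => /(_ isT).
Qed.

Lemma poly_zero_seq (a : nat -> F) (P : {poly F}) :
  injective a -> (forall m, P.[a m] = 0) -> P = 0.
Proof.
move=> inja P0; apply/eqP; apply: contraT => /(exists_nonroot inja)[m].
by rewrite P0 eqxx.
Qed.

(** The form in which identities between coefficients are extracted: here the
    points [a m] are either natural numbers or points of the unit circle. *)
Lemma coef_zero_seq (a : nat -> F) n (c : nat -> F) : injective a ->
    (forall m, \sum_(k < n) c k * a m ^+ k = 0) ->
  forall k, (k < n)%N -> c k = 0.
Proof.
move=> inja c0 k kn.
have : \poly_(i < n) c i = 0.
  by apply: (poly_zero_seq inja) => m; rewrite horner_poly.
by move/(congr1 (coefp k)); rewrite /= coef0 coef_poly kn.
Qed.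

End Polynomials.

(** * The representation of SU(2) on binary forms *)
Section Rho.
Variables (C : numClosedFieldType) (d : nat).
Implicit Types (g h : 'M[C]_2) (w : 'cV[C]_2).

Definition hom_vec w : 'cV[C]_d.+1 := \col_(l < d.+1) hom_basis d l w.

Lemma hom_vec_rho g w : (rho_irr d g)^T *m hom_vec w = hom_vec (g^t* *m w).
Proof.
apply/matrixP => l j; rewrite !mxE rho_irrE.
by apply: eq_bigr => k _; rewrite [_^T _ _]mxE [hom_vec _ _ _]mxE mulrC.
Qed.

Lemma natr_inj : injective (fun m : nat => m%:R : C).
Proof. by move=> m1 m2 /eqP; rewrite eqr_nat => /eqP. Qed.

Lemma sqrt_bin_neq0 l : (l <= d)%N -> sqrtC 'C(d, l)%:R != 0 :> C.
Proof. by move=> ld; rewrite sqrtC_eq0 pnatr_eq0 -lt0n bin_gt0. Qed.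

(** The monomials are linearly independent, so the vectors [hom_vec w] span.
    Every identity about [rho_irr] below is obtained by testing it on them. *)
Lemma hom_vec_sep m (M N : 'M[C]_(m, d.+1)) :
  (forall w, M *m hom_vec w = N *m hom_vec w) -> M = N.
Proof.
move=> MN; apply/matrixP => i l.
pose c k := (M i (inord k) - N i (inord k)) * sqrtC 'C(d, k)%:R.
have /(coef_zero_seq natr_inj)/(_ l (ltn_ord l)) (t : nat) :
    \sum_(k < d.+1) c k * t%:R ^+ k = 0.
  pose w : 'cV[C]_2 := \col_(k < 2) (if k == 0 then 1 else t%:R).
  have /matrixP/(_ i 0)/eqP := MN w.
  rewrite -subr_eq0 !mxE -sumrB => /eqP e; rewrite -[RHS]e.
  apply: eq_bigr => k _; rewrite -mulrBl !mxE /c inord_val /hom_basis !mxE /=.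
  by rewrite expr1n mulr1 mulrA.
move/eqP; rewrite /c inord_val mulf_eq0 (negPf (sqrt_bin_neq0 _)) -1?ltnS //.
by rewrite orbF subr_eq0 => /eqP.
Qed.

Lemma rho_irrM g h : rho_irr d (g *m h) = rho_irr d g *m rho_irr d h.
Proof.
apply: trmx_inj; apply: hom_vec_sep => w; rewrite trmx_mul -mulmxA !hom_vec_rho.
by rewrite mulmxA trmx_mul map_mxM.
Qed.

Lemma rho_irr1 : rho_irr d (1%:M : 'M[C]_2) = 1%:M.
Proof.
apply: trmx_inj; apply: hom_vec_sep => w; rewrite hom_vec_rho.
by rewrite !trmx1 map_mx1 !mul1mx.
Qed.

(** The binomial theorem, thanks to the normalization of the basis: this is the
    reproducing kernel that makes the representation unitary. *)
Lemma hom_vec_dot w w' :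
  (hom_vec w)^T *m hom_vec w' = ((w^T *m w') 0 0 ^+ d)%:M.
Proof.
have -> : (w^T *m w') 0 0 = w 0 0 * w' 0 0 + w 1 0 * w' 1 0.
  rewrite mxE big_ord_recl big_ord1 !mxE.
  by rewrite (_ : lift ord0 ord0 = 1); last exact: val_inj.
rewrite [LHS]mx11_scalar; congr _%:M; rewrite mxE exprDn; apply: eq_bigr => k _.
rewrite !mxE /hom_basis !exprMn -[RHS]mulr_natr.
by rewrite -[in RHS](sqrtCK ('C(d, k)%:R : C)); ring.
Qed.

Lemma rho_irr_trmx h : rho_irr d h^T = (rho_irr d h)^T.
Proof.
apply: hom_vec_sep => w'; apply: trmx_inj; apply: hom_vec_sep => w.
rewrite trmx_mul -mulmxA !hom_vec_rho !hom_vec_dot.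
by rewrite trmx_mul -mulmxA map_trmx !trmxK.
Qed.

Lemma rho_irr_conj h :
  rho_irr d (map_mx Num.conj h) = map_mx Num.conj (rho_irr d h).
Proof.
have conj_hom w : map_mx Num.conj (hom_vec w) = hom_vec (map_mx Num.conj w).
  apply/matrixP => l j; rewrite !mxE /hom_basis !mxE !rmorphM !rmorphXn /=.
  by rewrite geC0_conj // sqrtC_ge0 ler0n.
have conjK m (M : 'M[C]_(2, m)) : map_mx Num.conj (map_mx Num.conj M) = M.
  by apply/matrixP => i j; rewrite !mxE conjCK.
apply: trmx_inj; apply: hom_vec_sep => w; rewrite hom_vec_rho.
rewrite -[w]conjK -!conj_hom !map_trmx -!map_mxM conj_hom hom_vec_rho conj_hom.
by congr hom_vec; rewrite [RHS]map_mxM /= !conjK.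
Qed.

Lemma rho_irr_adj h : rho_irr d (h^t*) = (rho_irr d h)^t*.
Proof. by rewrite rho_irr_conj rho_irr_trmx. Qed.

Lemma rho_irr_unitary h : h^t* *m h = 1%:M ->
  (rho_irr d h)^t* *m rho_irr d h = 1%:M.
Proof. by move=> hh; rewrite -rho_irr_adj -rho_irrM hh rho_irr1. Qed.

(** The image of [w] under the quaternionic structure of the plane, which
    commutes with SU(2) and sends each vector to an orthogonal one. *)
Definition perp w : 'cV[C]_2 :=
  \col_(k < 2) (if k == 0 then - (w 1 0)^* else (w 0 0)^*).

Lemma exp_linear_poly (a b : C) n :
  (a%:P + b *: 'X) ^+ n = \poly_(i < n.+1) (a ^+ (n - i) * b ^+ i *+ 'C(n, i)).
Proof.
rewrite exprDn poly_def; apply: eq_bigr => i _.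
by rewrite exprZn -rmorphXn /= mul_polyC scalerA scalerMnl.
Qed.

(** The Veronese maps are the Taylor coefficients of the map of degree [d] in
    the direction [perp w]: the entry of index [l] of the left-hand side is, up
    to its normalization, [(u - t v^* )^(d - l) (v + t u^* )^l], and the sum
    defining [veronese_hom] is the Cauchy product of two binomial expansions. *)
Lemma hom_vec_perp w (t : C) :
  hom_vec (w + t *: perp w) = \sum_(p < d.+1) t ^+ p *: veronese_hom d p w.
Proof.
apply/matrixP => l j; rewrite summxE mxE /hom_basis !mxE /=.
set u := w 0 0; set v := w 1 0.
have ld : (l <= d)%N by rewrite -ltnS.
pose a i := u ^+ (d - l - i) * (- v^*) ^+ i *+ 'C(d - l, i).
pose b i := v ^+ (l - i) * u^* ^+ i *+ 'C(l, i).
pose A : {poly C} := \poly_(i < (d - l).+1) a i.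
pose B : {poly C} := \poly_(i < l.+1) b i.
have AB_t : (A * B).[t] = (u + t * - v^*) ^+ (d - l) * (v + t * u^*) ^+ l.
  by rewrite hornerM /A /B /a /b -!exp_linear_poly !hornerE /= ![t * _]mulrC.
rewrite -mulrA -AB_t (@horner_coef_wide _ d.+1); last first.
  apply: leq_trans (size_polyMleq _ _) _.
  have := size_poly (d - l).+1 a; have := size_poly l.+1 b.
  rewrite -/A -/B; lia.
rewrite mulr_sumr; apply: eq_bigr => p _; rewrite !mxE -/u -/v coefM.
rewrite [RHS]mulrCA [_ * t ^+ p]mulrC; congr (_ * (_ * _)).
apply: eq_bigr => k _; rewrite !coef_poly !ltnS /a /b.
have [lt|le] := ltnP (d - l) k.
  by rewrite mul0r (bin_small lt) muln0 mulr0 mul0r.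
have [lt|le'] := ltnP l (p - k).
  by rewrite mulr0 (bin_small lt) mul0n mulr0 mul0r.
rewrite natrM [(- v^*) ^+ _]exprNn.
rewrite -(mulr_natr (u ^+ _ * _)) -(mulr_natr (v ^+ _ * _)).
move: ('C(d - l, k)%:R : C) ('C(l, p - k)%:R : C) ((-1) ^+ k) => x1 x2 x3.
move: (u ^+ _) (u^* ^+ _) (v ^+ _) (v^* ^+ _) => x4 x5 x6 x7.
by ring.
Qed.

End Rho.

(** * Equivariance and rigidity of the Veronese maps *)
Section Equivariance.
Variables (C : numClosedFieldType) (d : nat).

(** The first column of [g] determines the second: [g 1 1] is the conjugate of
    [g 0 0], and [g 0 1] is minus the conjugate of [g 1 0]. *)
Lemma perp_SU2 (g : 'M[C]_2) w :
  g^t* *m g = 1%:M -> \det g = 1 -> perp (g *m w) = g *m perp w.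
Proof.
move=> gg dg.
have sumE (f : 'I_2 -> C) : \sum_i f i = f 0 + f 1.
  by rewrite big_ord_recl big_ord1; congr (_ + f _); apply: val_inj.
have /matrixP := gg => /[dup] /(_ 0 0) + /(_ 0 1).
rewrite !mxE !sumE !mxE /= ?mulr1n ?mulr0n => e00 e01.
move: dg; rewrite (expand_det_row _ 0) sumE /cofactor !det_mx11 !mxE /=.
rewrite (_ : lift 0 0 = 1); last exact: val_inj.
rewrite (_ : lift 1 0 = 0); last exact: val_inj.
rewrite /= expr0 expr1 mul1r mulN1r mulrN => det.
have d_eq : g 1 1 = (g 0 0)^*.
  rewrite -[LHS]mul1r -e00 -[RHS]mulr1 -det.
  have -> : (g 0 0)^* * (g 0 0 * g 1 1 - g 0 1 * g 1 0) =
    (g 0 0)^* * g 0 0 * g 1 1 - (g 0 0)^* * g 0 1 * g 1 0 by ring.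
  have -> : (g 0 0)^* * g 0 1 = - ((g 1 0)^* * g 1 1).
    by apply/eqP; rewrite -addr_eq0 e01.
  by ring.
have b_eq : g 0 1 = - (g 1 0)^*.
  rewrite -[(g 1 0)^*]mulr1 -det.
  have -> : (g 1 0)^* * (g 0 0 * g 1 1 - g 0 1 * g 1 0) =
    g 0 0 * ((g 1 0)^* * g 1 1) - (g 1 0)^* * g 0 1 * g 1 0 by ring.
  have -> : (g 1 0)^* * g 1 1 = - ((g 0 0)^* * g 0 1).
    by apply/eqP; rewrite -addr_eq0 addrC e01.
  by rewrite -[LHS]mul1r -e00; ring.
apply/matrixP => i j; rewrite !mxE !sumE !mxE /=.
case: i => [[|[|//]] hi] /=.
- rewrite (_ : Ordinal hi = 0); last exact: val_inj.
  by rewrite !rmorphD !rmorphM /= d_eq b_eq conjCK; ring.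
- rewrite (_ : Ordinal hi = 1); last exact: val_inj.
  by rewrite !rmorphD !rmorphM /= d_eq b_eq rmorphN /= conjCK; ring.
Qed.

(** By [perp_SU2] the whole Taylor polynomial of [hom_vec_perp] is equivariant,
    hence so is each of its coefficients. The conjugate of [g] appears because
    [rho_irr] lets [g] act through its adjoint and the coordinate vector of a
    point transforms dually to the basis of polynomials. *)
Lemma veronese_hom_SU2 p (g : 'M[C]_2) w : (p <= d)%N ->
    g^t* *m g = 1%:M -> \det g = 1 ->
  veronese_hom d p (g *m w) =
    rho_irr d (map_mx Num.conj g) *m veronese_hom d p w.
Proof.
move=> pd gg dg.
have -> : map_mx Num.conj g = (g^t*)^T by rewrite map_trmx trmxK.
rewrite rho_irr_trmx; set T := (rho_irr d _)^T.
apply/matrixP => l j; apply/eqP; rewrite -subr_eq0; apply/eqP.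
pose c q := veronese_hom d q (g *m w) l j - (T *m veronese_hom d q w) l j.
apply: (@coef_zero_seq _ _ d.+1 c (@natr_inj C)) => // m.
have E : hom_vec d (g *m w + m%:R *: perp (g *m w)) =
         T *m hom_vec d (w + m%:R *: perp w).
  by rewrite /T hom_vec_rho trmxCK mulmxDr -scalemxAr perp_SU2.
move: E; rewrite !hom_vec_perp mulmx_sumr => /matrixP/(_ l j)/eqP.
rewrite -subr_eq0 !summxE -sumrB => /eqP e; rewrite -[RHS]e.
by apply: eq_bigr => k _; rewrite -scalemxAr /c !mxE mulrC mulrBr.
Qed.

(** The Cayley transform supplies infinitely many points of the unit circle. *)
Definition circle_pt (m : nat) : C := (1 + 'i * m%:R) / (1 - 'i * m%:R).

Lemma circle_pt_neq0 m : 1 - 'i * m%:R != 0 :> C.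
Proof.
rewrite subr_eq0; apply/eqP => /(congr1 (fun x => x ^+ 2)); apply/eqP.
rewrite exprMn sqrCi expr1n mulN1r -subr_eq0 opprK.
by rewrite -natrX nat1r pnatr_eq0.
Qed.

Lemma circle_pt_inj : injective circle_pt.
Proof.
move=> m n; rewrite /circle_pt => /eqP; rewrite eqr_div ?circle_pt_neq0 //.
rewrite -subr_eq0.
have -> : (1 + 'i * m%:R) * (1 - 'i * n%:R) - (1 + 'i * n%:R) * (1 - 'i * m%:R)
  = 2 * 'i * (m%:R - n%:R) :> C by ring.
by rewrite !mulf_eq0 pnatr_eq0 (negPf (neq0Ci _)) /= subr_eq0 eqr_nat => /eqP.
Qed.

Lemma circle_pt_norm m : `|circle_pt m| = 1.
Proof.
rewrite normf_div (_ : 1 + 'i * m%:R = (1 - 'i * m%:R)^*); last first.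
  by rewrite rmorphB rmorph1 rmorphM /= conjCi conjC_nat mulNr opprK.
by rewrite norm_conjC divff // normr_eq0 circle_pt_neq0.
Qed.

(** On a circle [|z| = |z0|] the Veronese vector is, up to the factor [w^-p],
    a monomial curve whose coefficients [b l] do not depend on [w]. For a generic
    radius none of them vanishes, and this single curve is enough for the span
    and the rigidity statements, by comparison of coefficients. *)
Lemma veronese_circle p : (p <= d)%N -> exists (z0 : C) (b : nat -> C),
  (forall l, (l <= d)%N -> b l != 0) /\
  forall w, `|w| = 1 ->
    w ^+ p *: veronese d p (z0 * w) = \col_(l < d.+1) (b l * w ^+ l).
Proof.
move=> pd.
pose H l : {poly C} :=
  \poly_(k < p.+1) ((-1) ^+ k * ('C(l, p - k) * 'C(d - l, k))%:R).
have H0 l : (l <= d)%N -> H l != 0.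
  move=> ld; apply/eqP => /(congr1 (coefp (p - l))); rewrite /= coef0 coef_poly.
  rewrite ltnS leq_subr => /eqP; rewrite mulf_eq0 signr_eq0 /= pnatr_eq0.
  have := bin_gt0 l (p - (p - l)); have := bin_gt0 (d - l) (p - l).
  by rewrite muln_eq0 !lt0n; case: eqP => _; case: eqP => _; lia.
(* The radius is chosen as a positive integer [m.+1], at whose square none of
   the [H l] vanishes. *)
have [m] : exists m, (\prod_(l < d.+1) H l).[(m.+1%:R ^+ 2)] != 0.
  apply: (@exists_nonroot _ (fun m => m.+1%:R ^+ 2)) => [m n /eqP|].
    by rewrite -!natrX eqr_nat eqn_exp2r // eqSS => /eqP.
  by apply/prodf_neq0 => l _; rewrite H0 // -ltnS.
rewrite horner_prod => /prodf_neq0 Hm.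
pose r : C := m.+1%:R.
pose b l := p`!%:R / (1 + r ^+ 2) ^+ p * sqrtC 'C(d, l)%:R *
  r ^ (l%:Z - p%:Z) * (H l).[r ^+ 2].
have r0 : r != 0 by rewrite pnatr_eq0.
exists r, b; split=> [l ld|w w1].
  have:= Hm (inord l) isT; rewrite inordK ?ltnS // => ?.
  rewrite !mulf_neq0 ?expfz_neq0 ?sqrt_bin_neq0 // ?pnatr_eq0 -?lt0n ?fact_gt0 //.
  by rewrite invr_eq0 expf_neq0 // -natrX nat1r pnatr_eq0.
have w0 : w != 0 by rewrite -normr_eq0 w1 oner_eq0.
apply/matrixP => l j; rewrite !mxE /veronese_coord normrM w1 mulr1.
rewrite normr_nat -/r /b horner_poly exprzMl ?unitfE //.
have -> : w ^+ l = w ^+ p * w ^ (l%:Z - p%:Z).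
  by rewrite !exprnP -expfzDr // addrC subrK.
under [in RHS]eq_bigr => k _ do rewrite -exprM.
by ring.
Qed.

Lemma veronese_span p m (M : 'M[C]_(m, d.+1)) : (p <= d)%N ->
  (forall z, M *m veronese d p z = 0) -> M = 0.
Proof.
move=> pd M0; have [z0 [b [b0 bE]]] := veronese_circle pd.
apply/matrixP => i l; rewrite mxE.
pose c k := M i (inord k) * b k.
have /eqP : c l = 0.
  apply: (coef_zero_seq circle_pt_inj) (ltn_ord l) => t.
  have /(congr1 (fun v => circle_pt t ^+ p *: v)) := M0 (z0 * circle_pt t).
  move=> /matrixP/(_ i 0).
  rewrite /= scalemxAr bE ?circle_pt_norm // scaler0 !mxE => e; rewrite -[RHS]e.
  by apply: eq_bigr => k _; rewrite mxE /c inord_val mulrA.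
by rewrite /c inord_val mulf_eq0 (negPf (b0 _ _)) ?orbF -1?ltnS // => /eqP.
Qed.

(** Along the monomial curve [W] of [veronese_circle], proportionality of [U W]
    and [W] says that the polynomials [W_j (U W)_i] and [W_i (U W)_j] coincide.
    With [i = 0] and [j = d] the degrees force [(U W)_0] to be constant; with
    [j = 0] this determines each row of [U]. *)
Lemma veronese_rigid p (U : 'M[C]_d.+1) : (p <= d)%N ->
  (forall z, exists c, U *m veronese d p z = c *: veronese d p z) ->
  exists c, U = c%:M.
Proof.
move=> pd Uz; have [z0 [b [b0 bE]]] := veronese_circle pd.
pose A i : {poly C} := \poly_(l < d.+1) (U i (inord l) * b l).
have AE i t : (A i).[circle_pt t] =
    (U *m \col_(l < d.+1) (b l * circle_pt t ^+ l)) i 0.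
  rewrite horner_poly mxE; apply: eq_bigr => k _.
  by rewrite mxE inord_val mulrA.
have prop (i j : 'I_d.+1) : (b j)%:P * ('X^j * A i) = (b i)%:P * ('X^i * A j).
  apply/eqP; rewrite -subr_eq0; apply/eqP.
  apply: (poly_zero_seq circle_pt_inj) => t.
  rewrite hornerD hornerN !hornerM !hornerC !hornerXn !AE.
  have [c e] := Uz (z0 * circle_pt t).
  have {}e : U *m (\col_(l < d.+1) (b l * circle_pt t ^+ l)) =
    c *: \col_(l < d.+1) (b l * circle_pt t ^+ l).
    rewrite -bE ?circle_pt_norm // -scalemxAr e scalerA mulrC -scalerA.
    by rewrite scalerA mulrC -scalerA.
  by rewrite e !mxE; ring.
have Acoef i k : (A i)`_k = if (k < d.+1)%N then U i (inord k) * b k else 0.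
  by rewrite coef_poly.
have A0 k : (0 < k)%N -> (A ord0)`_k = 0.
  move=> k0; have /(congr1 (coefp (d + k))) := prop ord0 ord_max.
  rewrite /= mul1r !coefCM coefXnM ltnNge leq_addr /= addKn.
  rewrite (Acoef ord_max) ltnS.
  rewrite [(d + k <= d)%N]leqNgt -[X in (X < _)%N]addn0 ltn_add2l k0 /= mulr0.
  by move/eqP; rewrite mulf_eq0 (negPf (b0 _ _)) //= => /eqP.
exists (U ord0 ord0); apply/matrixP => i l; rewrite mxE.
have /(congr1 (coefp l)) := prop i ord0.
rewrite /= mul1r !coefCM coefXnM (Acoef i) ltn_ord inord_val.
have nb k : (k < d.+1)%N -> b k != 0 by rewrite ltnS => /b0.
have [->|nil] := eqVneq i l.
  rewrite ltnn subnn Acoef /= => e.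
  have [n0 nl] := (nb _ (ltn0Sn d), nb _ (ltn_ord l)).
  apply: (mulfI n0); apply: (mulIf nl); rewrite mulr1n -mulrA e.
  have -> : inord 0 = ord0 :> 'I_d.+1 by apply: val_inj; rewrite /= inordK.
  by ring.
rewrite mulr0n => e; apply/eqP; have /eqP : b 0 * (U i l * b l) = 0.
  rewrite e; case: ltnP => [|le]; first by rewrite mulr0.
  by rewrite A0 ?mulr0 // subn_gt0 ltn_neqAle le andbT.
by rewrite !mulf_eq0 (negPf (nb _ _)) // (negPf (nb l _)) // orbF.
Qed.

End Equivariance.

(** * Adjoints and the passage between complex and real frames *)
Section Adjoint.
Variable C : numClosedFieldType.

Lemma adjmxM m n q (A : 'M[C]_(m, n)) (B : 'M[C]_(n, q)) :
  (A *m B)^t* = B^t* *m A^t*.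
Proof. by rewrite trmx_mul map_mxM. Qed.

Lemma adjmxB m n (A B : 'M[C]_(m, n)) : (A - B)^t* = A^t* - B^t*.
Proof. by rewrite linearB map_mxB. Qed.

Lemma adjmx1 n : (1%:M : 'M[C]_n)^t* = 1%:M.
Proof. by rewrite trmx1 map_mx1. Qed.

Lemma adjmxZ m n c (A : 'M[C]_(m, n)) : (c *: A)^t* = c^* *: A^t*.
Proof. by rewrite linearZ map_mxZ. Qed.

Lemma adjmx_tr m n (A : 'M[C]_(m, n)) : (A^T)^t* = (A^t*)^T.
Proof. by rewrite map_trmx. Qed.

Lemma adjmx_scalar n (a : C) : (a%:M : 'M[C]_n)^t* = a^*%:M.
Proof. by rewrite tr_scalar_mx map_scalar_mx. Qed.

Lemma mul_adj_ge0 n (u : 'rV[C]_n) : 0 <= (u *m u^t*) 0 0.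
Proof.
by rewrite mxE sumr_ge0 // => k _; rewrite !mxE -normCK exprn_ge0.
Qed.

Lemma mul_adj_gt0 n (u : 'rV[C]_n) : u != 0 -> 0 < (u *m u^t*) 0 0.
Proof.
move=> u0; rewrite lt_def mul_adj_ge0 andbT; apply: contra u0.
have ge0 k : true -> 0 <= u 0 k * u^t* k 0.
  by rewrite !mxE -normCK exprn_ge0.
rewrite mxE (psumr_eq0 _ ge0) => /allP u0; apply/eqP/matrixP => i k.
have := u0 k (mem_index_enum _); rewrite ord1 !mxE -normCK expf_eq0 normr_eq0.
by move=> /eqP.
Qed.

Lemma adjmx_block m1 m2 n1 n2 (A : 'M[C]_(m1, n1)) (B : 'M_(m1, n2))
    (D : 'M_(m2, n1)) (E : 'M_(m2, n2)) :
  (block_mx A B D E)^t* = block_mx (A^t*) (D^t*) (B^t*) (E^t*).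
Proof. by rewrite tr_block_mx map_block_mx. Qed.

(** Right multiplication by this matrix turns a row [(x, y)] into
    [(x + i y, x - i y)]; up to the factor [sqrt 2] it is unitary. *)
Definition realify N : 'M[C]_(N + N) :=
  block_mx 1%:M 1%:M 'i%:M (- 'i)%:M.

Lemma realify_adj N : realify N *m (realify N)^t* = 2%:M.
Proof.
rewrite /realify adjmx_block mulmx_block !adjmx_scalar !mul_scalar_mx.
rewrite !scale_scalar_mx rmorphN /= conjCi conjC1 opprK.
rewrite !mulr1 !mul1r mulrN mulNr -expr2 sqrCi opprK.
rewrite -!(raddfD (@scalar_mx C N)) /=.
by rewrite [RHS]scalar_mx_block subrr addNr raddf0.
Qed.

Lemma realify_adjC N : (realify N)^t* *m realify N = 2%:M.
Proof.
have two0 : (2 : C) != 0 by rewrite pnatr_eq0.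
have := realify_adj N => /(congr1 (fun M => 2^-1 *: M)).
rewrite scale_scalar_mx mulVf // scalemxAr => /mulmx1C.
rewrite -scalemxAl => /(congr1 (fun M => 2 *: M)).
by rewrite scalerA divff // scale1r scale_scalar_mx mulr1.
Qed.

Lemma realify_inj N (A B : 'M[C]_(N + N)) :
    realify N *m A *m (realify N)^t* = realify N *m B *m (realify N)^t* ->
  A = B.
Proof.
move/(congr1 (fun X => (realify N)^t* *m X *m realify N)).
rewrite !mulmxA realify_adjC -!mulmxA realify_adjC !mulmxA.
rewrite !mul_scalar_mx !mul_mx_scalar !scalerA.
by apply: scalerI; rewrite mulf_neq0 ?pnatr_eq0.
Qed.

(** For real [X] and [Y], and [S = X + i Y], the middle factor is the Gram
    matrix of a frame [E] together with its conjugate when [E^* E = 1] and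
    [E^T E = S]; the right-hand side is, up to a scalar, the Gram matrix of the
    real and imaginary parts of [E]. *)
Lemma realify_dilation N (X Y : 'M[C]_N) :
  realify N *m block_mx 1%:M (X - 'i *: Y) (X + 'i *: Y) 1%:M
    *m (realify N)^t* =
  2 *: block_mx (1%:M + X) Y Y (1%:M - X).
Proof.
move SE: (X + 'i *: Y) => S; move S'E: (X - 'i *: Y) => S'.
rewrite /realify adjmx_block !mulmx_block !adjmx_scalar rmorphN /= conjCi.
rewrite conjC1 opprK !mul_scalar_mx !mul_mx_scalar !scale1r !scale_block_mx.
rewrite -SE -S'E.
have i2 : 'i ^+ 2 + 1 = 0 :> C by rewrite sqrCi addNr.
congr block_mx; apply/matrixP => a b; rewrite !mxE;
  move: (X a b) (Y a b) ((a == b)%:R) => x y e.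
- by ring.
- apply/eqP; rewrite -subr_eq0; apply/eqP.
  transitivity (- 2 * y * ('i ^+ 2 + 1)); last by rewrite i2 mulr0.
  by ring.
- apply/eqP; rewrite -subr_eq0; apply/eqP.
  transitivity (- 2 * y * ('i ^+ 2 + 1)); last by rewrite i2 mulr0.
  by ring.
- apply/eqP; rewrite -subr_eq0; apply/eqP.
  transitivity (- 2 * (e - x) * ('i ^+ 2 + 1)); last by rewrite i2 mulr0.
  by ring.
Qed.

End Adjoint.
Arguments realify {C} N.

(** * Complex frames with a prescribed symmetric Gram matrix *)
Section Contractions.
Variable R : realType.
Local Notation C := R[i].

(** In an orthonormal eigenbasis of [S^* S] the form is diagonal with entries
    one minus an eigenvalue, and each eigenvalue, being the squared length of
    [v S^*] for a unit eigenvector [v], is the square of a singular value. *)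
Lemma singular_le1_psd N (S : 'M[C]_N) :
    (forall s, singular_value S s -> s <= 1) ->
  forall x : 'rV[C]_N, 0 <= (x *m (1%:M - S^t* *m S) *m x^t*) 0 0.
Proof.
move=> sing x; set A := S^t* *m S.
have adjA : A^t* = A by rewrite adjmxM trmxCK.
have /orthomx_spectralP : A \is normalmx by apply/normalmxP; rewrite adjA.
set P := spectralmx A; set D := spectral_diag A => AE.
have PU : P \is unitarymx by apply: spectral_unitarymx.
have PP := unitarymxP PU.
rewrite invmx_unitary // in AE.
have D_le1 j : D 0 j <= 1.
  pose v := row j P.
  have vv : v *m v^t* = 1%:M.
    have /matrixP/(_ j j) := PP.
    rewrite [RHS]mxE eqxx => e; rewrite [LHS]mx11_scalar; congr _%:M.
    by rewrite -[RHS]e !mxE; apply: eq_bigr => k _; rewrite !mxE.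
  have vA : v *m A = D 0 j *: v.
    rewrite /v -row_mul {1}AE !mulmxA PP mul1mx.
    by rewrite row_mul row_diag_mx -scalemxAl -rowE.
  have DE : D 0 j = ((v *m S^t*) *m (v *m S^t*)^t*) 0 0.
    rewrite adjmxM trmxCK !mulmxA -(mulmxA v) -/A vA -scalemxAl vv !mxE eqxx.
    by rewrite mulr1.
  have D0 : 0 <= D 0 j by rewrite DE mul_adj_ge0.
  have Dr : (complex.Re (D 0 j))%:C%C = D 0 j by rewrite RRe_real // ger0_real.
  have r0 : 0 <= complex.Re (D 0 j) by rewrite -ler0c Dr.
  have sE : real_complex R (Num.sqrt (complex.Re (D 0 j))) ^+ 2 = D 0 j.
    by rewrite -rmorphXn /= sqr_sqrtr.
  have /sing s1 : singular_value S (Num.sqrt (complex.Re (D 0 j))).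
    rewrite /singular_value sqrtr_ge0 sE; apply/eigenvalueP; exists v => //.
    apply/eqP => v0; move: vv; rewrite v0 mul0mx => /matrixP/(_ 0 0)/eqP.
    by rewrite !mxE eq_sym oner_eq0.
  rewrite -sE -rmorphXn -[1](rmorph1 (real_complex R)) lecR.
  by rewrite expr_le1 // sqrtr_ge0.
pose y := x *m P^t*.
have xE : x = y *m P by rewrite /y mulmxKtV.
have -> : x *m (1%:M - A) *m x^t* = y *m diag_mx (const_mx 1 - D) *m y^t*.
  have PE : P *m (1%:M - A) *m P^t* = diag_mx (const_mx 1 - D).
    rewrite mulmxBr mulmx1 mulmxBl PP AE !mulmxA PP mul1mx -mulmxA PP mulmx1.
    by rewrite linearB /= diag_const_mx.
  by rewrite -PE xE adjmxM !mulmxA.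
rewrite mul_mx_diag mxE sumr_ge0 // => k _; rewrite !mxE.
by rewrite mulrAC -normCK mulr_ge0 ?exprn_ge0 // subr_ge0.
Qed.

Lemma map_mx_real_adj m n (A : 'M[R]_(m, n)) :
  (map_mx (real_complex R) A)^t* = map_mx (real_complex R) A^T.
Proof. by apply/matrixP => i j; rewrite !mxE; apply: conjc_real. Qed.

Local Notation cplx A := (map_mx (real_complex R) A).

Definition re_mx m n (A : 'M[C]_(m, n)) := map_mx (@complex.Re R) A.
Definition im_mx m n (A : 'M[C]_(m, n)) := map_mx (@complex.Im R) A.

Lemma re_im_mx m n (A : 'M[C]_(m, n)) :
  A = cplx (re_mx A) + 'i *: cplx (im_mx A).
Proof. by apply/matrixP => i j; rewrite !mxE -complexiE -complexE. Qed.

Lemma conj_re_im_mx m n (A : 'M[C]_(m, n)) :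
  map_mx Num.conj A = cplx (re_mx A) - 'i *: cplx (im_mx A).
Proof.
apply/matrixP => i j; rewrite !mxE {1}[A i j]complexE -complexiE.
rewrite rmorphD rmorphM /= complexiE conjCi mulNr.
congr (_ - _ * _); exact: conjc_real.
Qed.

(** The real and imaginary parts of the columns of [E]. Real orthogonal matrices
    act on [E] on the left, so that the invariants of [E] under them are carried
    by the real Gram matrix of this frame. *)
Definition real_frame m N (E : 'M[C]_(m, N)) : 'M[R]_(m, N + N) :=
  row_mx (re_mx E) (im_mx E).

Lemma real_frameE m N (E : 'M[C]_(m, N)) :
  cplx (real_frame E) *m realify N = row_mx E (map_mx Num.conj E).
Proof.
rewrite map_row_mx /realify mul_row_block !mul_mx_scalar !scale1r scaleNr.
by rewrite -re_im_mx -conj_re_im_mx.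
Qed.

Lemma conj_frame_gram m N (E : 'M[C]_(m, N)) :
  (row_mx E (map_mx Num.conj E))^t* *m row_mx E (map_mx Num.conj E) =
  block_mx (E^t* *m E) (map_mx Num.conj (E^T *m E))
           (E^T *m E) (map_mx Num.conj (E^t* *m E)).
Proof.
have conjK q r (M : 'M[C]_(q, r)) : map_mx Num.conj (map_mx Num.conj M) = M.
  by apply/matrixP => i j; rewrite !mxE conjCK.
rewrite tr_row_mx map_col_mx mul_col_row !map_mxM /=.
by rewrite -!map_trmx /= !conjK.
Qed.

(** The real Gram matrix of the frame is equivalent data to the pair formed by
    [E^* E] and [E^T E]. *)
Lemma real_frame_gram m N (E : 'M[C]_(m, N)) :
  cplx ((real_frame E)^T *m real_frame E) = 4^-1 *: (realify N *m
    block_mx (E^t* *m E) (map_mx Num.conj (E^T *m E))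
             (E^T *m E) (map_mx Num.conj (E^t* *m E)) *m (realify N)^t*).
Proof.
rewrite -conj_frame_gram -real_frameE adjmxM map_mx_real_adj.
rewrite !mulmxA realify_adj -!mulmxA realify_adj !mulmxA.
rewrite mul_scalar_mx mul_mx_scalar -!scalemxAl !scalerA map_mxM.
have -> : 4^-1 * 2 * 2 = 1 :> C by field.
by rewrite scale1r.
Qed.

(** Two isometries with the same [E^T E] have the same real Gram matrix by
    [real_frame_gram], so [gram_orthogonal] applies. *)
Lemma gram_unique m N (E E' : 'M[C]_(m, N)) :
    E^t* *m E = E'^t* *m E' -> E^T *m E = E'^T *m E' ->
  exists2 A : 'M[R]_m, A^T *m A = 1%:M & E' = cplx A *m E.
Proof.
move=> herm sym.
have /gram_orthogonal[A oA AE] : (real_frame E)^T *m real_frame E =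
    (real_frame E')^T *m real_frame E'.
  apply: (@map_mx_inj _ _ (real_complex R)).
  by rewrite !real_frame_gram herm sym.
exists A => //.
have [re_eq im_eq] : re_mx E' = A *m re_mx E /\ im_mx E' = A *m im_mx E.
  by apply: eq_row_mx; rewrite -mul_mx_row.
by rewrite [LHS]re_im_mx re_eq im_eq !map_mxM scalemxAr -mulmxDr -re_im_mx.
Qed.

(** The real Gram matrix [G] that [E] must have is known from [S]. It is
    congruent to the block matrix [H] with diagonal blocks [1] and off-diagonal
    blocks [S^*] and [S], and completing the square in [H] leaves [1 - S^* S] and
    [1]. Hence [G] is positive and its rank is controlled by that of
    [1 - S^* S], and [psd_factor] realizes it in dimension [m]. *)
Lemma gram_exists m N (S : 'M[C]_N) : S^T = S ->
    (forall x : 'rV[C]_N, 0 <= (x *m (1%:M - S^t* *m S) *m x^t*) 0 0) ->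
    (\rank (1%:M - S^t* *m S)%R + N <= m)%N ->
  exists2 E : 'M[C]_(m, N), E^t* *m E = 1%:M & E^T *m E = S.
Proof.
move=> symS psd rk; set M := 1%:M - S^t* *m S in psd rk.
have conjS : map_mx Num.conj S = S^t* by rewrite symS.
pose H : 'M[C]_(N + N) := block_mx 1%:M (S^t*) S 1%:M.
pose D : 'M[C]_(N + N) := block_mx M 0 0 1%:M.
pose K : 'M[C]_(N + N) := block_mx 1%:M (S^t*) 0 1%:M.
have HE : H = K *m D *m K^t*.
  rewrite /K /D adjmx_block !adjmx1 trmxCK trmx0 map_mx0 !mulmx_block.
  by rewrite !(mulmx0, mul0mx, mulmx1, mul1mx, addr0, add0r) subrK.
pose G : 'M[R]_(N + N) := 2^-1 *:
  block_mx (1%:M + re_mx S) (im_mx S) (im_mx S) (1%:M - re_mx S).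
have GE : cplx G = 4^-1 *: (realify N *m H *m (realify N)^t*).
  have -> : cplx G = 2^-1 *: block_mx (1%:M + cplx (re_mx S)) (cplx (im_mx S))
                               (cplx (im_mx S)) (1%:M - cplx (re_mx S)).
    rewrite /G map_mxZ map_block_mx map_mxD map_mxB map_mx1; congr (_ *: _).
    by rewrite fmorphV rmorph_nat.
  rewrite /H -conjS conj_re_im_mx [X in block_mx 1%:M _ X _]re_im_mx.
  by rewrite realify_dilation scalerA; congr (_ *: _); field.
have symG : G^T = G.
  rewrite linearZ /= tr_block_mx linearB linearD /= !trmx1.
  by rewrite /re_mx /im_mx !map_trmx symS.
have psdG (x : 'rV[R]_(N + N)) : 0 <= (x *m G *m x^T) 0 0.
  rewrite -ler0c.
  have -> : ((x *m G *m x^T) 0 0)%:C%C = (cplx (x *m G *m x^T)) 0 0.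
    by rewrite [RHS]mxE.
  pose y := cplx x *m realify N *m K.
  have -> : cplx (x *m G *m x^T) = 4^-1 *: (y *m D *m y^t*).
    rewrite !map_mxM GE HE -map_mx_real_adj /y !adjmxM.
    by rewrite -!scalemxAr -!scalemxAl !mulmxA.
  rewrite mxE mulr_ge0 ?invr_ge0 //.
  rewrite -[y]hsubmxK /D mul_row_block !mulmx0 mulmx1 addr0 add0r.
  rewrite tr_row_mx map_col_mx mul_row_col mxE addr_ge0 //.
  by rewrite mul_adj_ge0.
have rkG : (\rank G <= m)%N.
  rewrite -(mxrank_map (real_complex R)) GE HE.
  rewrite mxrank_scale_nz ?invr_eq0 ?pnatr_eq0 //.
  rewrite !mulmxA; apply: leq_trans (mxrankM_maxl _ _) _.
  apply: leq_trans (mxrankM_maxl _ _) _.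
  apply: leq_trans (mxrankM_maxr _ _) _.
  by rewrite /D rank_diag_block_mx mxrank1.
have [F GF] := psd_factor symG psdG rkG.
pose E := cplx (lsubmx F) + 'i *: cplx (rsubmx F).
have FE : F = real_frame E.
  rewrite -[LHS]hsubmxK; congr row_mx; apply/matrixP => i j;
    by rewrite !mxE -complexiE /=; ring.
have four0 : (4^-1 : C) != 0 by rewrite invr_eq0 pnatr_eq0.
move: GE; rewrite GF FE real_frame_gram => /(scalerI four0)/realify_inj.
by rewrite /H => /eq_block_mx[EE _ ES _]; exists E.
Qed.

End Contractions.

(** * Singular values of the symmetric Gram matrix of an isometry *)
Section Isometries.
Variable R : realType.
Local Notation C := R[i].
Variables (m N : nat) (E : 'M[C]_(m, N)).
Hypothesis isoE : E^t* *m E = 1%:M.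
Let S := E^T *m E.
Let q : 'M[C]_m := 1%:M - map_mx Num.conj E *m E^T.

Let trE_conj : E^T *m map_mx Num.conj E = 1%:M.
Proof.
apply: trmx_inj; rewrite trmx_mul trmxK trmx1 -isoE; congr (_ *m _).
by rewrite map_trmx.
Qed.

(** [q] is the orthogonal projection onto the complement of the range of the
    conjugate of [E]. So [1 - S^* S] is positive, and its rank is at most the
    codimension of the range of [E]; this gives both conditions on the singular
    values of [S]. *)
Lemma isometry_defect : 1%:M - S^t* *m S = (E^t* *m q) *m (E^t* *m q)^t*.
Proof.
have adjq : q^t* = q.
  rewrite adjmxB adjmx1 adjmxM; congr (_ - _ *m _); apply/matrixP => i j;
    by rewrite !mxE ?conjCK.
rewrite adjmxM trmxCK adjq !mulmxA -(mulmxA _ q q).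
have -> : q *m q = q.
  rewrite {1}/q mulmxBl mul1mx {2}/q mulmxBr mulmx1 -!mulmxA (mulmxA E^T).
  by rewrite trE_conj mul1mx subrr subr0.
rewrite /q mulmxBr mulmxBl mulmx1 isoE /S adjmxM.
rewrite adjmx_tr map_trmx trmxK.
by rewrite !mulmxA.
Qed.

Lemma isometry_gram_singular_le1 s : singular_value S s -> s <= 1.
Proof.
case/andP=> s0 /eigenvalueP[v vS v0].
have := mul_adj_ge0 (v *m (E^t* *m q)).
rewrite adjmxM mulmxA -(mulmxA v) -isometry_defect mulmxBr mulmx1 vS.
rewrite mulmxBl -scalemxAl -[X in X - _]scale1r -scalerBl mxE.
rewrite pmulr_lge0 ?mul_adj_gt0 // subr_ge0 -rmorphXn.
rewrite -[1](rmorph1 (real_complex R)).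
by rewrite lecR expr_le1.
Qed.

Lemma isometry_gram_mult : (N + N - m <= singular_mult S 1)%N.
Proof.
have rkE : \rank E^T = N.
  apply/eqP; rewrite eqn_leq rank_leq_row -[X in (X <= _)%N](mxrank1 C N).
  by rewrite -trE_conj mxrankM_maxl.
have rkq : (N + \rank q <= m)%N.
  rewrite -{1}rkE mulmx0_rank_max // /q mulmxBr mulmx1 mulmxA trE_conj mul1mx.
  by rewrite subrr.
rewrite /singular_mult /eigenspace rmorph1 expr1n mxrank_ker.
have -> : \rank (S^t* *m S - 1%:M)%R = \rank (1%:M - S^t* *m S)%R.
  by rewrite -opprB mxrank_opp.
have : (\rank (1%:M - S^t* *m S)%R <= \rank q)%N.
  rewrite isometry_defect; apply: leq_trans (mxrankM_maxl _ _) _.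
  exact: mxrankM_maxr.
move: rkq; lia.
Qed.

End Isometries.

(** * Lines and null vectors *)
Section Lines.
Variable C : numClosedFieldType.

Lemma CP_line n (x : CP C n) : exists2 v, v != 0 & sval x = <[v]>%VS.
Proof.
case: x => L /= dL; have L0 : L != 0%VS by rewrite -dimv_eq0 (eqP dL).
exists (vpick L); first by rewrite vpick0.
apply/esym/eqP; rewrite eqEdim -memvE memv_pick dim_vline vpick0 L0.
by rewrite (eqP dL).
Qed.

Lemma CP_inj n (x y : CP C n) : sval x = sval y -> x = y.
Proof. by move=> xy; apply: val_inj. Qed.

Lemma CPmap_line m n (E : isom_mx C m n) x v :
  sval x = <[v]>%VS -> sval (CPmap E x) = <[sval E *m v]>%VS.
Proof. by move=> /= ->; rewrite limg_line lfunE. Qed.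

Lemma line_scale n (v w : 'cV[C]_n) :
  <[v]>%VS = <[w]>%VS -> exists c, w = c *: v.
Proof. by move=> vw; apply/vlineP; rewrite vw memv_line. Qed.

Lemma scale_line n (c : C) (v : 'cV[C]_n) :
  c != 0 -> <[c *: v]>%VS = <[v]>%VS.
Proof.
move=> c0; apply/eqP; rewrite eqEsubv -!memvE memvZ ?memv_line //=.
by rewrite -[X in X \in _](scalerK c0) memvZ ?memv_line.
Qed.

Lemma CPmap_comp m n q (E : isom_mx C m n) (F : isom_mx C n q)
    (G : isom_mx C m q) x :
  sval G = sval E *m sval F -> CPmap E (CPmap F x) = CPmap G x.
Proof.
move=> GE; have [v v0 xv] := CP_line x; apply: CP_inj.
rewrite (CPmap_line _ (CPmap_line _ xv)) (CPmap_line _ xv) GE.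
by rewrite mulmxA.
Qed.

Lemma CPmap_id n (E : isom_mx C n n) x : sval E = 1%:M -> CPmap E x = x.
Proof.
move=> E1; have [v v0 xv] := CP_line x; apply: CP_inj.
by rewrite (CPmap_line _ xv) E1 mul1mx.
Qed.

Lemma veronese_map_line d (p : 'I_d.+1) (x : CP C 1) (w : 'cV[C]_2) :
    w != 0 -> sval x = <[w]>%VS ->
  sval (veronese_map p x) = <[veronese_hom d p w]>%VS.
Proof.
move=> w0 xw; rewrite /= -veroneseLE //.
have /vlineP[c e] : vpick (sval x) \in <[w]>%VS by rewrite -xw memv_pick.
rewrite e veroneseLZ //; apply: contraNneq w0 => c0.
move/eqP: e; rewrite c0 scale0r vpick0 xw -dimv_eq0 dim_vline eqb0 negbK.
by move=> ->.
Qed.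

Lemma quadric_line n (x : CP C n) v : sval x = <[v]>%VS ->
  quadric x <-> v^T *m v = 0.
Proof.
have sqE (w : 'cV[C]_n.+1) : (w^T *m w) 0 0 = \sum_i w i 0 ^+ 2.
  by rewrite mxE; apply: eq_bigr => i _; rewrite mxE.
move=> xv; split=> [qx | vv w].
  by rewrite [LHS]mx11_scalar sqE qx ?raddf0 // xv memv_line.
rewrite xv => /vlineP[c ->]; rewrite -sqE -scalemxAr [_^T]linearZ /=.
rewrite -scalemxAl vv.
by rewrite !scaler0 mxE.
Qed.

Definition affine_vec (z : C) : 'cV[C]_2 :=
  \col_(k < 2) (if k == 0 then 1 else z).

(** The hypothesis covers the lines with [u <> 0]. The point at infinity
    is the limit of [(t, v)] as [t] tends to [0]; along real [t] the left-hand
    side is a polynomial in [t], which vanishes for [t = 1, 2, ...] and hence at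
    [t = 0]. *)
Lemma veronese_hom_null d p (S : 'M[C]_d.+1) : (p <= d)%N ->
    (forall z, (veronese d p z)^T *m S *m veronese d p z = 0) ->
  forall w : 'cV[C]_2, w != 0 ->
    (veronese_hom d p w)^T *m S *m veronese_hom d p w = 0.
Proof.
move=> pd S0.
have generic (w : 'cV[C]_2) : w 0 0 != 0 ->
    (veronese_hom d p w)^T *m S *m veronese_hom d p w = 0.
  move=> w0; have := S0 (w 1 0 / w 0 0); rewrite veronese_homE //.
  set c := (_ / _ / _); have c0 : c != 0.
    rewrite mulf_neq0 ?veronese_factor_neq0 // invr_neq0 //.
    by rewrite mulf_neq0 ?expf_neq0 ?conjC_eq0.
  rewrite -scalemxAr [_^T]linearZ /= -!scalemxAl scalerA => /eqP.
  by rewrite scaler_eq0 mulf_eq0 (negPf c0) => /eqP.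
move=> w w_neq0; have [u0|] := eqVneq (w 0 0) 0; last exact: generic.
pose v := w 1 0.
pose wt (t : nat) : 'cV[C]_2 := \col_(k < 2) (if k == 0 then t%:R else v).
pose V : 'cV[{poly C}]_d.+1 := \col_(l < d.+1) ((sqrtC 'C(d, l)%:R)%:P *
    \sum_(k < p.+1) ((-1) ^+ k * ('C(l, p - k) * 'C(d - l, k))%:R)%:P *
      ('X ^+ (d - l - k) * (v ^+ (l - (p - k)))%:P *
       'X ^+ (p - k) * (v^* ^+ k)%:P)).
have VE t : veronese_hom d p (wt t) = map_mx (horner_eval t%:R) V.
  apply/matrixP => l j; rewrite !mxE /= horner_evalE hornerCM; congr (_ * _).
  rewrite horner_sum; apply: eq_bigr => k _; rewrite conjC_nat.
  by rewrite hornerCM !hornerM !hornerXn !hornerC.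
pose Q := (V^T *m map_mx polyC S *m V) 0 0.
have QE t : Q.[t%:R] =
    ((veronese_hom d p (wt t))^T *m S *m veronese_hom d p (wt t)) 0 0.
  have SE : S = map_mx (horner_eval t%:R) (map_mx polyC S).
    by apply/matrixP => i j; rewrite !mxE /= horner_evalE hornerC.
  by rewrite VE {1}SE map_trmx -!map_mxM [RHS]mxE.
have wE : w = wt 0%N.
  apply/matrixP => i j; rewrite mxE ord1; case: i => [[|[|//]] hi] /=.
    by transitivity (w 0 0); [congr (w _ _); apply: val_inj | rewrite u0].
  by congr (w _ _); apply: val_inj.
rewrite wE [LHS]mx11_scalar -QE.
have -> : Q = 0.
  apply: (@poly_zero_seq _ (fun m => m.+1%:R)) => [m n /eqP|t].
    by rewrite eqr_nat eqSS => /eqP.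
  by rewrite QE generic ?mxE // pnatr_eq0.
by rewrite horner0 raddf0.
Qed.
End Lines.

(** * The two equivalence relations and the bijection *)
Section Moduli.
Variable R : realType.
Local Notation C := R[i].
Local Notation cplx A := (map_mx (real_complex R) A).

Lemma isomP m n (E : isom_mx C m n) : (sval E)^t* *m sval E = 1%:M.
Proof. by case: E => E /= /eqP. Qed.

Lemma isom_mul_neq0 m n (E : isom_mx C m n) (v : 'cV[C]_n.+1) :
  v != 0 -> sval E *m v != 0.
Proof.
apply: contraNneq => Ev0.
by rewrite -[v]mul1mx -(isomP E) -mulmxA Ev0 mulmx0.
Qed.

Lemma SU2P (g : SU2 C) :
  (sval (sval g))^t* *m sval (sval g) = 1%:M /\ \det (sval (sval g)) = 1.
Proof. by split; [apply: isomP | case: g => g /= /eqP]. Qed.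

Lemma SU2_exists (g : 'M[C]_2) : g^t* *m g = 1%:M -> \det g = 1 ->
  exists h : SU2 C, sval (sval h) = g.
Proof.
move=> /eqP gg /eqP dg.
by exists (exist _ (exist _ g gg : isom_mx C 1 1) dg : SU2 C).
Qed.

Lemma SU2_1 : exists h : SU2 C, sval (sval h) = 1%:M.
Proof. by apply: SU2_exists; rewrite ?det1 // adjmx1 mulmx1. Qed.

Lemma SU2_mul (g h : SU2 C) :
  exists k : SU2 C, sval (sval k) = sval (sval g) *m sval (sval h).
Proof.
have [gg dg] := SU2P g; have [hh dh] := SU2P h.
apply: SU2_exists; last by rewrite det_mulmx dg dh mulr1.
by rewrite adjmxM !mulmxA -(mulmxA _ _ (sval (sval g))) gg mulmx1.
Qed.

Lemma SU2_adj (g : SU2 C) :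
  exists k : SU2 C, sval (sval k) = (sval (sval g))^t*.
Proof.
have [gg dg] := SU2P g; apply: SU2_exists.
  by rewrite trmxCK; apply: mulmx1C.
by rewrite det_map_mx det_tr dg rmorph1.
Qed.

Lemma SU2_conj (g : SU2 C) :
  exists k : SU2 C, sval (sval k) = map_mx Num.conj (sval (sval g)).
Proof.
have [gg dg] := SU2P g.
apply: SU2_exists; last by rewrite det_map_mx dg rmorph1.
by rewrite map_trmx -map_mxM gg map_mx1.
Qed.

Lemma orthogonal_exists n (A : 'M[R]_n.+1) : A^T *m A = 1%:M ->
  exists B : real_orthogonal R n, sval B = A.
Proof. by move=> /eqP oA; exists (exist _ A oA). Qed.

Lemma orthogonalP n (A : real_orthogonal R n) : (sval A)^T *m sval A = 1%:M.
Proof. by case: A => A /= /eqP. Qed.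

Section Equivalence.
Variable n : nat.
Implicit Types f : CP C 1 -> CP C n.

Lemma sphere_equiv_refl f : sphere_equiv f f.
Proof.
have [g g1] := SU2_1.
have [|A A1] := @orthogonal_exists n 1%:M; first by rewrite trmx1 mulmx1.
by exists A, g => x; rewrite !CPmap_id //= A1 map_mx1.
Qed.

Lemma sphere_equiv_sym f f' : sphere_equiv f f' -> sphere_equiv f' f.
Proof.
move=> [A [g ff']]; have [h hE] := SU2_adj g.
have oA := orthogonalP A; have [gg _] := SU2P g.
have [|B BE] := @orthogonal_exists n (sval A)^T.
  by rewrite trmxK; apply: mulmx1C.
have [h1 h1E] := SU2_1.
have [|B1 B1E] := @orthogonal_exists n 1%:M; first by rewrite trmx1 mulmx1.
exists B, h => x; rewrite ff'.
have -> : CPmap (sval g) (CPmap (sval h) x) = x.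
  rewrite (@CPmap_comp _ _ _ _ _ _ (sval h1)) ?CPmap_id //.
  by rewrite h1E hE; apply/esym; apply: mulmx1C.
rewrite (@CPmap_comp _ _ _ _ _ _ (complexify B1)) ?CPmap_id //=.
  by rewrite B1E map_mx1.
by rewrite B1E BE -map_mxM oA map_mx1.
Qed.

Lemma sphere_equiv_trans f1 f2 f3 :
  sphere_equiv f1 f2 -> sphere_equiv f2 f3 -> sphere_equiv f1 f3.
Proof.
move=> [A [g f12]] [B [h f23]]; have [k kE] := SU2_mul g h.
have [|D DE] := @orthogonal_exists n (sval B *m sval A).
  rewrite trmx_mul mulmxA -(mulmxA _ _ (sval B)) orthogonalP mulmx1.
  exact: orthogonalP.
exists D, k => x; rewrite f23 f12.
rewrite (@CPmap_comp _ _ _ _ _ _ (complexify D))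
        ?(@CPmap_comp _ _ _ _ _ _ (sval k)) //=.
by rewrite DE map_mxM.
Qed.

Lemma HH_class_eq d (p : 'I_d.+1) f f' :
  sphere_equiv f f' -> HH_class p f = HH_class p f'.
Proof.
move=> ff'; apply/seteqP; split=> h /= [Hh fh]; split=> //.
  exact: sphere_equiv_trans (sphere_equiv_sym ff') fh.
exact: sphere_equiv_trans ff' fh.
Qed.

End Equivalence.

Section Orbits.
Variable d : nat.
Implicit Types S T : 'M[C]_d.+1.

Lemma SS_orbit_refl S : SS_orbit S S.
Proof.
have [g g1] := SU2_1; exists 1, g; rewrite scale1r; split; first exact: normr1.
by rewrite g1 rho_irr1 trmx1 mul1mx mulmx1.
Qed.

Lemma SS_orbit_sym S T : SS_orbit S T -> SS_orbit T S.
Proof.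
move=> [l [g [l1 ->]]]; have [h hE] := SU2_adj g; have [gg _] := SU2P g.
have rr : rho_irr d (sval (sval g)) *m rho_irr d (sval (sval h)) = 1%:M.
  by rewrite -rho_irrM hE (mulmx1C gg) rho_irr1.
exists l^-1, h; split; first by rewrite normfV l1 invr1.
rewrite -!scalemxAr -!scalemxAl scalerA mulVf ?scale1r; last first.
  by rewrite -normr_eq0 l1 oner_eq0.
by rewrite -!mulmxA rr mulmx1 mulmxA -trmx_mul rr trmx1 mul1mx.
Qed.

Lemma SS_orbit_trans S1 S2 S3 :
  SS_orbit S1 S2 -> SS_orbit S2 S3 -> SS_orbit S1 S3.
Proof.
move=> [l [g [l1 ->]]] [m [h [m1 ->]]]; have [k kE] := SU2_mul g h.
exists (m * l), k; split; first by rewrite normrM l1 m1 mulr1.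
by rewrite kE rho_irrM trmx_mul -!scalemxAr -!scalemxAl scalerA !mulmxA.
Qed.

Lemma SS_orbit_eq S T : SS_orbit S T -> SS_orbit S = SS_orbit T.
Proof.
move=> ST; apply/seteqP; split=> U.
  exact/SS_orbit_trans/SS_orbit_sym.
exact: SS_orbit_trans.
Qed.

End Orbits.

Section Spheres.
Variables (d n : nat) (p : 'I_d.+1).
Implicit Types E : isom_mx C n d.
Let pd : (p <= d)%N. Proof. by rewrite -ltnS. Qed.
Let gram E := (sval E)^T *m sval E.

Lemma sphere_line E x w : w != 0 -> sval x = <[w]>%VS ->
  sval (sphere p E x) = <[sval E *m veronese_hom d p w]>%VS.
Proof. by move=> w0 xw; apply: CPmap_line; apply: veronese_map_line. Qed.

Lemma affine_vec_neq0 (z : C) : affine_vec z != 0.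
Proof. by apply/eqP => /matrixP/(_ 0 0)/eqP; rewrite !mxE oner_eq0. Qed.

Lemma veronese_affine (z : C) :
  exists c, veronese d p z = c *: veronese_hom d p (affine_vec z).
Proof.
have := @veronese_homE C d p (affine_vec z) pd.
rewrite !mxE /= divr1 oner_eq0 => /(_ isT) ->; by eexists.
Qed.

(** Since [(E v)^T (E v) = v^T (E^T E) v], the sphere lies in the quadric
    exactly when its Veronese lift is null for [E^T E]. *)
Lemma HH_sphere E : HH n p (sphere p E) <-> scrS p (gram E).
Proof.
have gramE v : (sval E *m v)^T *m (sval E *m v) = v^T *m gram E *m v.
  by rewrite trmx_mul !mulmxA.
split=> [[E' _ qE] | [_ S0]]; last first.
  exists E => // x; have [w w0 xw] := CP_line x.
  apply/(quadric_line (sphere_line E w0 xw)).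
  by rewrite gramE; apply: veronese_hom_null.
split=> [|z]; first by rewrite trmx_mul trmxK.
have [c ->] := veronese_affine z.
have /(quadric_line (sphere_line E (affine_vec_neq0 z) _)) :=
  qE (Defs.point (affine_vec_neq0 z)).
rewrite gramE => /(_ erefl) q0.
by rewrite -scalemxAr [_^T]linearZ /= -!scalemxAl q0 !scaler0.
Qed.

(** If [E'^T E'] is the transform of [E^T E] by [l] and [g], then [E'] and
    [sqrtC l *: (E *m rho_irr d g)] are isometries with the same symmetric Gram
    matrix, so a real orthogonal matrix carries one to the other; by
    equivariance [rho_irr d g] amounts to a reparametrization by the conjugate
    of [g]. *)
Lemma sphere_equiv_orbit E E' :
  SS_orbit (gram E) (gram E') -> sphere_equiv (sphere p E) (sphere p E').
Proof.
move=> [l [g [l1 gE]]]; have [h hE] := SU2_conj g; have [gg dg] := SU2P g.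
have [hh dh] := SU2P h.
pose r := rho_irr d (sval (sval g)).
have m1 : `|sqrtC l| = 1.
  by apply/eqP; rewrite -(@eqrXn2 _ 2) // -normrX sqrtCK l1 expr1n.
have m0 : sqrtC l != 0 by rewrite -normr_eq0 m1 oner_eq0.
pose N := sqrtC l *: (sval E *m r).
have [|| A oA AE] := @gram_unique R _ _ N (sval E').
- rewrite isomP /N adjmxZ adjmxM -scalemxAr -scalemxAl scalerA -normCK m1.
  by rewrite expr1n scale1r mulmxA -(mulmxA (r^t*)) isomP mulmx1 rho_irr_unitary.
- rewrite -/(gram E') gE /N -scalemxAr [_^T]linearZ /= -scalemxAl scalerA.
  by rewrite -expr2 sqrtCK trmx_mul /gram !mulmxA.
have [B BE] := orthogonal_exists oA.
exists B, h => x; have [w w0 xw] := CP_line x; apply: CP_inj.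
rewrite (sphere_line E' w0 xw).
have hw0 := isom_mul_neq0 (sval h) w0.
rewrite (CPmap_line _ (sphere_line E hw0 (CPmap_line _ xw))) /= BE.
rewrite veronese_hom_SU2 // hE -map_mx_comp.
rewrite (@map_mx_id _ _ _ _ (@conjCK _)) -/r.
by rewrite AE /N -scalemxAr -scalemxAl !mulmxA scale_line.
Qed.

(** Equality of the two spheres as maps says that [E'] and the isometry
    [N = A E rho] send every Veronese vector to the same line. Then [N^* E']
    preserves every Veronese line, so it is a scalar [c] by [veronese_rigid], and
    [E' = c N] because the Veronese vectors span. *)
Lemma orbit_sphere_equiv E E' :
  sphere_equiv (sphere p E) (sphere p E') -> SS_orbit (gram E) (gram E').
Proof.
move=> [A [g EE']]; have [h hE] := SU2_conj g; have [gg dg] := SU2P g.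
have [hh dh] := SU2P h.
pose r := rho_irr d (sval (sval h)).
pose N := cplx (sval A) *m sval E *m r.
have NN : N^t* *m N = 1%:M.
  rewrite /N !adjmxM map_mx_real_adj !mulmxA -[_ *m cplx (sval A)]mulmxA.
  rewrite -(map_mxM (real_complex R)).
  rewrite orthogonalP map_mx1 mulmx1 -(mulmxA (r^t*)) isomP mulmx1.
  exact: rho_irr_unitary.
have EN z : exists c, sval E' *m veronese d p z = c *: (N *m veronese d p z).
  have w0 := affine_vec_neq0 z; have [k ->] := veronese_affine z.
  have gw0 := isom_mul_neq0 (sval g) w0.
  have := congr1 sval (EE' (Defs.point w0)).
  rewrite (sphere_line E' w0) //.
  rewrite (CPmap_line _ (sphere_line E gw0 (CPmap_line _ _))) //=.
  rewrite veronese_hom_SU2 // -hE !mulmxA -/r -/N => /esym/line_scale[c e].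
  by exists c; rewrite -!scalemxAr e !scalerA mulrC.
have [|c UE] := @veronese_rigid C d p (N^t* *m sval E') pd.
  move=> z; have [c e] := EN z; exists c.
  by rewrite -mulmxA e -scalemxAr mulmxA NN mul1mx.
have E'N : sval E' = c *: N.
  apply/eqP; rewrite -subr_eq0; apply/eqP; apply: (veronese_span pd) => z.
  have [c' e] := EN z.
  have /eqP : N^t* *m (sval E' *m veronese d p z) = c *: veronese d p z.
    by rewrite mulmxA UE mul_scalar_mx.
  rewrite e -scalemxAr mulmxA NN mul1mx -subr_eq0 -scalerBl scaler_eq0.
  rewrite (negPf (veronese_neq0 _ pd)) orbF subr_eq0 => /eqP <-.
  by rewrite mulmxBl e -scalemxAl subrr.
have c1 : `|c| = 1.
  have /matrixP/(_ 0 0) := isomP E'.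
  rewrite E'N adjmxZ -scalemxAr -scalemxAl NN scalerA -normCK scale_scalar_mx.
  rewrite !mxE mulr1 => /eqP.
  rewrite mulr1n -[X in _ == X](expr1n _ 2) eqrXn2 //.
  by move=> /eqP.
exists (c ^+ 2), h; split; first by rewrite normrX c1 expr1n.
rewrite /gram E'N -scalemxAr [_^T]linearZ /= -scalemxAl scalerA -expr2.
rewrite /N !trmx_mul !mulmxA -[_ *m cplx (sval A)]mulmxA map_trmx.
rewrite -(map_mxM (real_complex R)).
by rewrite orthogonalP map_mx1 mulmx1.
Qed.

Lemma gram_SS E : HH n p (sphere p E) -> SS n p (gram E).
Proof.
move=> /HH_sphere S0; split=> // [s|].
  by apply: isometry_gram_singular_le1; apply: isomP.
by apply: leq_trans (isometry_gram_mult (isomP E)); lia.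
Qed.

(** The multiplicity of the singular value 1 is the dimension of the kernel of
    [1 - S^* S]; the required lower bound is exactly the rank condition of
    [gram_exists] for a target of dimension [n + 1]. *)
Lemma SS_gram (S : 'M[C]_d.+1) : (d <= n)%N -> SS n p S ->
  exists2 E, HH n p (sphere p E) & gram E = S.
Proof.
move=> dn [Sp sing mult].
have [||E /eqP EE ES] := @gram_exists R n.+1 d.+1 S _ (singular_le1_psd sing).
- by case: Sp.
- move: mult; rewrite /singular_mult /eigenspace rmorph1 expr1n mxrank_ker.
  have -> : \rank (S^t* *m S - 1%:M)%R = \rank (1%:M - S^t* *m S)%R.
    by rewrite -opprB mxrank_opp.
  have := rank_leq_row (1%:M - S^t* *m S)%R; move: (\rank _) => k; lia.
exists (exist _ E EE) => //; apply/HH_sphere.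
by rewrite /gram /= ES.
Qed.

End Spheres.
End Moduli.

Theorem theorem4p4 (R : realType) (d n : nat) (p : 'I_d.+1)
    (hd : (1 <= d)%N) (hdn : (d <= n)%N) (hn : (n <= 2 * d + 1)%N)
    (hp : (p <= d./2)%N) :
  exists Phi : set (CP R[i] 1 -> CP R[i] n) -> set 'M[R[i]]_d.+1,
    (forall E : isom_mx R[i] n d, HH n p (sphere p E) ->
       Phi (HH_class p (sphere p E)) = SS_orbit ((sval E)^T *m sval E)) /\
    set_bij (HH_quot R n p) (SS_quot R d n p) Phi.
Proof.
(* The union of the orbits of all representatives, which avoids choosing one;
   [PhiE] shows that they coincide. *)
pose Phi (X : set (CP R[i] 1 -> CP R[i] n)) : set 'M[R[i]]_d.+1 :=
  fun S => exists E : isom_mx R[i] n d,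
    X (sphere p E) /\ SS_orbit ((sval E)^T *m sval E) S.
have PhiE (E : isom_mx R[i] n d) : HH n p (sphere p E) ->
    Phi (HH_class p (sphere p E)) = SS_orbit ((sval E)^T *m sval E).
  move=> HE; apply/seteqP; split=> S /=.
    by move=> [E' [[_ /orbit_sphere_equiv/SS_orbit_eq ->]]].
  by move=> ES; exists E; do 2?split=> //; apply: sphere_equiv_refl.
exists Phi; split=> //; split.
- move=> _ /= [f Hf <-]; have [E fE _] := Hf; rewrite fE in Hf *.
  by rewrite PhiE //; exists ((sval E)^T *m sval E) => //; apply: gram_SS Hf.
- move=> X X' /set_mem[f Hf <-] /set_mem[f' Hf' <-].
  have [E fE _] := Hf; have [E' fE' _] := Hf'; rewrite fE fE' in Hf Hf' *.
  rewrite (PhiE _ Hf) (PhiE _ Hf') => EE'; apply/HH_class_eq/sphere_equiv_orbit.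
  by rewrite EE'; apply: SS_orbit_refl.
- move=> _ /= [S /(SS_gram hdn)[E HE <-] <-].
  by exists (HH_class p (sphere p E)); [exists (sphere p E) | rewrite PhiE].
Qed.
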